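(* Let $a<0$, $\sigma>0$, $T>0$, and let $x(t)$ be the solution of $\mathrm{d}x(t)=a\,x(t)\,\mathrm{d}t+\sigma\,\mathrm{d}w(t)$, $x(0)=0$, where $w$ is a standard Wiener process. Let $h>0$ be such that $N=T/h$ is a positive integer, let $M\ge 1$ be an integer and put $B=MN$. Let $x_1,\dots,x_M$ be independent copies of $x$, and define $$\hat V_M(h)=\frac1M\sum_{i=1}^M\sum_{k=0}^{N-1} h\,x_i^2(kh),\qquad V_T=\int_0^T\mathbb{E}[x^2(t)]\,\mathrm{d}t,\qquad \mathrm{MSE}_T(h,B)=\mathbb{E}\big[(\hat V_M(h)-V_T)^2\big].$$ Then $\mathrm{MSE}_T(h,B)=E_1(h,T,a)+\frac{E_2(h,T,a)}{B}$, where $$E_1(h,T,a)=\frac{\sigma^4\left(-2ah+e^{2ah}-1\right)^2\left(e^{2aT}-1\right)^2}{16a^4\left(e^{2ah}-1\right)^2},$$ $$E_2(h,T,a)=\frac{\sigma^4T\left[h\left(e^{2aT}-1\right)\left(4e^{2ah}+e^{2aT}+1\right)-\left(e^{2ah}-1\right)\left(e^{2ah}+4e^{2aT}+1\right)T\right]}{2a^2\left(e^{2ah}-1\right)^2}.$$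
   Context: This is the finite-horizon, undiscounted Monte-Carlo policy evaluation of a one-dimensional Langevin (linear quadratic) system with quadratic cost $x^2$ (cost weight $q=1$): the system horizon equals the estimation horizon $T$, the data budget is $B=M\cdot N$ (number of episodes times number of samples per episode), and $\hat V_M(h)$ is the average over $M$ episodes of the left Riemann sum of the cost with step-size $h$. *)

(* Defs.v *)
From HB Require Import structures.
From mathcomp Require Import all_boot all_order all_algebra.
From mathcomp Require Import all_classical all_reals all_analysis.
Set Implicit Arguments. Unset Strict Implicit. Unset Printing Implicit Defensive.
Import Order.TTheory GRing.Theory Num.Theory numFieldNormedType.Exports.
Local Open Scope classical_set_scope.
Local Open Scope ring_scope.

Section langevin_defs.
Context {d : measure_display} {Omega : measurableType d} {R : realType}.
Variable P : probability Omega R.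

(* Mutual independence of finitely many real random variables:
   product rule for every choice of Borel sets (taking B j = setT recovers
   the product rule for every subfamily). *)
Definition mutually_independent_rv (n : nat) (X : 'I_n -> Omega -> R) : Prop :=
  forall B : 'I_n -> set R, (forall j, measurable (B j)) ->
    P (\bigcap_(j in [set: 'I_n]) (X j @^-1` B j))
    = (\prod_(j < n) P (X j @^-1` B j))%E.

Definition independent_processes (M : nat) (X : 'I_M -> R -> Omega -> R) : Prop :=
  forall (n : nat) (t : 'I_n -> R) (B : 'I_M -> 'I_n -> set R),
    (forall i j, measurable (B i j)) ->
    P (\bigcap_(i in [set: 'I_M]) \bigcap_(j in [set: 'I_n]) (X i (t j) @^-1` B i j))
    = (\prod_(i < M) P (\bigcap_(j in [set: 'I_n]) (X i (t j) @^-1` B i j)))%E.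

Definition wiener_process (w : R -> Omega -> R) : Prop :=
  [/\ (forall t, measurable_fun setT (w t)),
      {ae P, forall om, w 0 om = 0},
      {ae P, forall om, {within `[0, +oo[%classic, continuous (fun t => w t om)}},
      (forall s t, 0 <= s -> s < t -> forall B, measurable B ->
          P ((fun om => w t om - w s om) @^-1` B) = normal_prob 0 (Num.sqrt (t - s)) B)
    & (forall (n : nat) (t : 'I_n.+2 -> R), 0 <= t ord0 ->
          (forall j : 'I_n.+1, t (widen_ord (leqnSn _) j) < t (lift ord0 j)) ->
          mutually_independent_rv
            (fun j : 'I_n.+1 => fun om => w (t (lift ord0 j)) om - w (t (widen_ord (leqnSn _) j)) om))].

(* x solves dx = a x dt + sigma dw, x(0) = 0, on t >= 0, in the (pathwise)
   integral form x(t) = a \int_0^t x(s) ds + sigma w(t), with continuous paths. *)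
Definition solves_langevin (a sigma : R) (w x : R -> Omega -> R) : Prop :=
  (forall t, measurable_fun setT (x t)) /\
  {ae P, forall om, {within `[0, +oo[%classic, continuous (fun t => x t om)} /\
     (forall t, 0 <= t ->
        x t om = a * Rintegral lebesgue_measure `[0, t] (fun s => x s om) + sigma * w t om)}.

End langevin_defs.

Definition E1 {R : realType} (sigma h T a : R) : R :=
  sigma ^+ 4 * (- (2 * a * h) + expR (2 * a * h) - 1) ^+ 2 * (expR (2 * a * T) - 1) ^+ 2
  / (16 * a ^+ 4 * (expR (2 * a * h) - 1) ^+ 2).

Definition E2 {R : realType} (sigma h T a : R) : R :=
  sigma ^+ 4 * T *
  (h * (expR (2 * a * T) - 1) * (4 * expR (2 * a * h) + expR (2 * a * T) + 1)
   - (expR (2 * a * h) - 1) * (expR (2 * a * h) + 4 * expR (2 * a * T) + 1) * T)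
  / (2 * a ^+ 2 * (expR (2 * a * h) - 1) ^+ 2).

(* Main.v *)
Require Import Defs.
From HB Require Import structures.
From mathcomp Require Import all_boot all_order all_algebra.
From mathcomp Require Import all_classical all_reals all_analysis.
From mathcomp Require Import measurable_realfun ring lra.
Import Order.TTheory GRing.Theory Num.Theory numFieldNormedType.Exports.
Local Open Scope classical_set_scope.
Local Open Scope ring_scope.

(** The mean square error is the squared bias [(m - V_T)^2] plus [s / M], where
    [m] and [s] are the mean and the variance of the cost of one episode, so
    everything reduces to the moments [E x(kh)^2] and [E x(kh)^2 x(lh)^2].
    These are computed on the Euler scheme
    [Y_(j+1) = (1 + a dt) Y_j + (w((j+1) dt) - w(j dt))], whose increments are
    independent and Gaussian. The scheme converges to [x / sigma] along almost
    every path, by uniform continuity of [x] alone: no stochastic calculus and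
    no explicit solution is needed. The moments pass to the limit because those
    of order 8 are bounded, which gives uniform integrability of
    [Y_i^2 Y_j^2]. *)

(** * Means and their almost sure limits *)

(** The process [x] is known only through its integral equation, while Gaussian laws and
    independence are given for the noise. Each probabilistic fact is therefore proved for functions
    of finitely many noise values and carried to [x] as an identity between moments. The step is
    [h / (n+1)], so every sampling time [k h] stays on the grid, at index [k (n+1)], for all [n].
    Since [a < 0], the factor [1 + a dt] has absolute value at most 1 for small [dt], so the local
    errors of the scheme add up without amplification. The noise has coefficient 1 in the scheme;
    [sigma] comes back at the end as a factor [sigma^2] or [sigma^4]. The mixed moments follow the
    pattern of centred Gaussian pairs, E[X^2 Y^2] = Var X Var Y + 2 Cov(X,Y)^2; the last term alone
    produces [s]. *)

Section has_mean.
Context {d : measure_display} {T : measurableType d} {R : realType}.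
Variable P : probability T R.
Implicit Types (X Y : T -> R) (e f c : R).

(** Integrability and value travel together, so sums, multiples and independent products compose
    without finiteness side conditions. *)
Definition has_mean X e :=
  P.-integrable setT (EFin \o X) /\ (\int[P]_t (X t)%:E = e%:E)%E.

Lemma has_mean_measurable X e : has_mean X e -> measurable_fun setT X.
Proof. by move=> [/measurable_int/measurable_EFinP]. Qed.

Lemma has_mean_expectation X e : has_mean X e -> 'E_P[X]%E = e%:E.
Proof. by move=> [_ <-]; rewrite unlock. Qed.

Lemma has_mean_cst c : has_mean (fun=> c) c.
Proof.
split; first exact: finite_measure_integrable_cst.
have /= -> := @integral_cst _ _ _ P setT measurableT c%:E.
by rewrite probability_setT mule1.
Qed.

Lemma has_meanD X Y e f :
  has_mean X e -> has_mean Y f -> has_mean (fun t => X t + Y t) (e + f).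
Proof.
move=> [iX EX] [iY EY]; split.
  by apply: eq_integrable (integrableD measurableT iX iY).
under eq_integral do rewrite EFinD.
by rewrite integralD// EX EY.
Qed.

Lemma has_meanZ X e c : has_mean X e -> has_mean (fun t => c * X t) (c * e).
Proof.
move=> [iX EX]; split.
  by apply: eq_integrable (integrableZl measurableT c iX).
under eq_integral do rewrite EFinM.
by rewrite integralZl// EX.
Qed.

Lemma has_mean_eq X Y e f : X =1 Y -> e = f -> has_mean X e -> has_mean Y f.
Proof. by move=> /funext -> ->. Qed.

Lemma has_mean_sum n (X : 'I_n -> T -> R) (e : 'I_n -> R) :
  (forall i, has_mean (X i) (e i)) ->
  has_mean (fun t => \sum_(i < n) X i t) (\sum_(i < n) e i).
Proof.
elim: n X e => [X e _|n IH X e XE].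
  by apply: has_mean_eq (has_mean_cst 0) => [t|]; rewrite big_ord0.
apply: has_mean_eq (has_meanD _ _ _ _ (IH _ _ (fun i => XE _)) (XE ord_max)) => [t|];
  by rewrite big_ord_recr.
Qed.

Lemma ge0_has_mean X e : measurable_fun setT X -> (forall t, 0 <= X t) ->
  (\int[P]_t (X t)%:E = e%:E)%E -> has_mean X e.
Proof.
move=> mX X0 EX; split => //; apply/integrableP; split.
  exact/measurable_EFinP.
by under eq_integral do rewrite /= ger0_norm//; rewrite EX ltry.
Qed.

Lemma has_mean_le X Y e f : has_mean X e -> has_mean Y f ->
  (forall t, X t <= Y t) -> e <= f.
Proof.
move=> [iX EX] [iY EY] XY; rewrite -lee_fin -EX -EY.
by apply: le_integral => // t _; rewrite lee_fin.
Qed.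

Lemma has_mean_dominated X Y f : measurable_fun setT X -> has_mean Y f ->
  (forall t, `|X t| <= Y t) -> exists e, has_mean X e.
Proof.
move=> mX [iY _] XY.
have iX : P.-integrable setT (EFin \o X).
  apply: le_integrable iY => //; first exact/measurable_EFinP.
  by move=> t _ /=; rewrite lee_fin (le_trans (XY t))// ler_norm.
exists (fine (\int[P]_t (X t)%:E)); split => //.
by rewrite fineK// integrable_fin_num.
Qed.

(* Truncating Z n at k + 1 loses at most K / (k + 1) of its mean, uniformly in n. *)
Lemma ae_cvg_has_mean (Z : (T -> R)^nat) X (c s : R^nat) c0 K :
  (forall n, has_mean (Z n) (c n)) -> (forall n t, 0 <= Z n t) ->
  (forall n, has_mean (fun t => Z n t ^+ 2) (s n)) -> (forall n, s n <= K) ->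
  measurable_fun setT X -> (forall t, 0 <= X t) ->
  {ae P, forall t, Z ^~ t @ \oo --> X t} -> c @ \oo --> c0 ->
  has_mean X c0.
Proof.
move=> Zc Z0 Zs sK mX X0 ZX cc0.
have mZ n := has_mean_measurable _ _ (Zc n).
pose trunc (k : nat) (z : R) := Num.min z k.+1%:R.
have tcont k : continuous (trunc k).
  move=> z; apply: (@continuous_min _ _ id (cst k.+1%:R)); first exact: cvg_id.
  exact: cvg_cst.
have mtr k Y : measurable_fun setT Y -> measurable_fun setT (trunc k \o Y).
  by move=> mY; apply: measurableT_comp => //; apply: continuous_measurable_fun.
have mE k Y : measurable_fun setT Y -> measurable_fun setT (EFin \o (trunc k \o Y)).
  by move=> mY; apply/measurable_EFinP; exact: mtr.
have tr0 k z : 0 <= z -> 0 <= trunc k z.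
  by move=> z0; rewrite le_min z0/=.
have trle k z : trunc k z <= k.+1%:R by rewrite ge_min lexx orbT.
have trZ n k : exists e, has_mean (trunc k \o Z n) e.
  apply: (has_mean_dominated _ _ _ (mtr _ _ (mZ n)) (has_mean_cst k.+1%:R)) => t /=.
  by rewrite ger0_norm ?trle// tr0.
pose cn n k := sval (cid (trZ n k)).
have cnE n k : has_mean (trunc k \o Z n) (cn n k) by rewrite /cn; case: cid.
have cn_ub n k : cn n k <= c n.
  by apply: (has_mean_le _ _ _ _ (cnE n k) (Zc n)) => t; rewrite /= ge_min lexx.
(* Integrates [z - z^2 / q <= min z q] with [q = k + 1]; for [z > q] this is
   [z^2 - q z + q^2 >= 0]. *)
have cn_lb n k : c n - k.+1%:R^-1 * K <= cn n k.
  apply: (@le_trans _ _ (c n + (- k.+1%:R^-1) * s n)).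
    rewrite mulNr lerD2l lerN2 ler_pM2l ?invr_gt0//; exact: sK.
  apply: (has_mean_le _ _ _ _ (has_meanD _ _ _ _ (Zc n) (has_meanZ _ _ _ (Zs n))) (cnE n k)) => t /=.
  rewrite /trunc minEle; case: ifPn => [_|].
    by rewrite mulNr lerBlDr lerDl mulr_ge0// ?sqr_ge0// invr_ge0.
  rewrite -ltNge => kZ.
  have k0 : (0:R) < k.+1%:R by rewrite ltr0n.
  rewrite mulNr lerBlDr -(ler_pM2l k0) mulrDr mulrA divff ?gt_eqF// mul1r.
  set z := Z n t in kZ *; set q := k.+1%:R in kZ k0 *; nra.
(* The limit in [n] is taken at fixed [k], where the constant [k + 1] dominates. The limit in [k]
   comes afterwards, by monotone convergence. *)
have Xk k : (\int[P]_t ((trunc k \o X) t)%:E <= c0%:E /\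
    (c0 - k.+1%:R^-1 * K)%:E <= \int[P]_t ((trunc k \o X) t)%:E)%E.
  have cnc : (cn n k)%:E @[n --> \oo] --> (\int[P]_x ((trunc k \o X) x)%:E)%E.
    have -> : (fun n => (cn n k)%:E) =
        (fun n => \int[P]_x ((trunc k \o Z n) x)%:E)%E.
      by apply/funext => n; rewrite (proj2 (cnE n k)).
    have [|||||_ _ //] := @dominated_convergence _ _ _ P setT measurableT
      (fun n => EFin \o (trunc k \o Z n)) (EFin \o (trunc k \o X)) (cst k.+1%:R%:E).
    - by move=> n; exact: mE.
    - exact: mE.
    - apply: filterS ZX => t Zt _; apply: cvg_EFin; first exact: nearW.
      exact: (@cvg_comp _ _ _ _ (trunc k) _ _ _ Zt (tcont k _)).
    - exact: finite_measure_integrable_cst.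
    - by apply: nearW => t n _ /=; rewrite lee_fin ger0_norm ?trle// tr0.
  have cc0' : (c n)%:E @[n --> \oo] --> c0%:E by apply: cvg_EFin => //; exact: nearW.
  have cc0'' : (c n - k.+1%:R^-1 * K)%:E @[n --> \oo] --> (c0 - k.+1%:R^-1 * K)%:E.
    by apply: cvg_EFin; [exact: nearW|apply: cvgB => //; exact: cvg_cst].
  split.
  - rewrite -(cvg_lim _ cnc)// -(cvg_lim _ cc0')//; apply: lee_lim.
    + by apply/cvg_ex; eexists; exact: cnc.
    + by apply/cvg_ex; eexists; exact: cc0'.
    + by apply: nearW => n; rewrite lee_fin cn_ub.
  - rewrite -(cvg_lim _ cnc)// -(cvg_lim _ cc0'')//; apply: lee_lim.
    + by apply/cvg_ex; eexists; exact: cc0''.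
    + by apply/cvg_ex; eexists; exact: cnc.
    + by apply: nearW => n; rewrite lee_fin cn_lb.
apply: ge0_has_mean => //.
have Xcvg : (\int[P]_t ((trunc k \o X) t)%:E @[k --> \oo] --> \int[P]_t (X t)%:E)%E.
  have -> : (\int[P]_t (X t)%:E =
      \int[P]_t limn (fun k => ((trunc k \o X) t)%:E))%E.
    apply: eq_integral => t _; apply/esym/cvg_lim => //.
    apply: cvg_EFin; first exact: nearW.
    apply: cvg_near_cst.
    exists (Num.truncn (X t)) => // k /= kX; rewrite /trunc/=; apply/min_idPl.
    by rewrite ltW//; apply: lt_le_trans (truncnS_gt _) _; rewrite ler_nat ltnS.
  apply: (@cvg_monotone_convergence _ _ _ P setT measurableT
    (fun k => EFin \o (trunc k \o X))) => [k|k t _|t _ k l kl] /=.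
  - exact: mE.
  - by rewrite lee_fin tr0.
  - by rewrite lee_fin le_min ge_min lexx/= ge_min ler_nat ltnS kl orbT.
rewrite -(cvg_lim _ Xcvg)//; apply/cvg_lim => //.
have lowc : (c0 - k.+1%:R^-1 * K)%:E @[k --> \oo] --> c0%:E.
  apply: cvg_EFin; first exact: nearW.
  rewrite -[X in _ --> X]subr0 -(mul0r K).
  apply: cvgB; first exact: cvg_cst.
  by apply: cvgMl; exact: cvg_harmonic.
apply: (squeeze_cvge _ lowc (cvg_cst _)).
by apply: nearW => k; rewrite (proj1 (Xk k)) (proj2 (Xk k)).
Qed.

End has_mean.

(** * Independence *)

Section independence.
Context {d : measure_display} {T : measurableType d} {R : realType}.
Variable P : probability T R.
Implicit Types (X Y : T -> R) (G H : set (set T)).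

Definition indep_rv X Y := forall A B : set R, measurable A -> measurable B ->
  P (X @^-1` A `&` Y @^-1` B) = (P (X @^-1` A) * P (Y @^-1` B))%E.

Lemma indep_rv_comp X Y (f g : R -> R) :
  measurable_fun setT f -> measurable_fun setT g ->
  indep_rv X Y -> indep_rv (f \o X) (g \o Y).
Proof.
move=> mf mg XY A B mA mB; apply: (XY (f @^-1` A) (g @^-1` B)).
  by rewrite -[X in measurable X]setTI; exact: mf.
by rewrite -[X in measurable X]setTI; exact: mg.
Qed.

(** Independence says that the joint law and the product of the marginal laws agree on rectangles,
    hence everywhere. Tonelli then gives integrability of the product, and Fubini its mean. *)
Lemma has_meanM X Y (e f : R) : indep_rv X Y ->
  has_mean P X e -> has_mean P Y f -> has_mean P (fun t => X t * Y t) (e * f).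
Proof.
move=> XY [iX EX] [iY EY].
have mX := has_mean_measurable _ _ _ (conj iX EX).
have mY := has_mean_measurable _ _ _ (conj iY EY).
pose X' : {mfun T >-> R} := HB.pack X (isMeasurableFun.Build _ _ _ _ X mX).
pose Y' : {mfun T >-> R} := HB.pack Y (isMeasurableFun.Build _ _ _ _ Y mY).
pose Z t := (X t, Y t).
have mZ : measurable_fun setT Z by exact: measurable_fun_pair.
pose Z' : {mfun T >-> (R * R)%type} := HB.pack Z (isMeasurableFun.Build _ _ _ _ Z mZ).
pose DX := distribution P X'; pose DY := distribution P Y'; pose DZ := distribution P Z'.
have DZE S : measurable S -> (DX \x DY)%E S = DZ S.
  by apply: (@product_measure_unique _ _ _ _ _ DX DY DZ) => A B mA mB; exact: XY.
have mf : measurable_fun setT (fun z : R * R => z.1 * z.2).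
  by apply: measurable_funM; [exact: measurable_fst|exact: measurable_snd].
have mF : measurable_fun setT (fun z : R * R => (z.1 * z.2)%:E).
  exact/measurable_EFinP.
have mXY : measurable_fun setT (fun t => X t * Y t) by exact: measurable_funM.
have iDX : DX.-integrable setT EFin by apply: integrable_pushforward.
have iDY : DY.-integrable setT EFin by apply: integrable_pushforward.
have EDX : (\int[DX]_x x%:E = e%:E)%E.
  by rewrite -EX /DX; apply: integral_pushforward.
have EDY : (\int[DY]_x x%:E = f%:E)%E.
  by rewrite -EY /DY; apply: integral_pushforward.
have iF : (DX \x DY)%E.-integrable setT (fun z : R * R => (z.1 * z.2)%:E).
  apply/integrable12ltyP => //=.
  have nY : (\int[DY]_y `|y%:E| < +oo)%E by case/integrableP : iDY.
  have -> : (\int[DX]_x \int[DY]_y `|x * y|%:E =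
      \int[DX]_x (`|x%:E| * \int[DY]_y `|y%:E|))%E.
    apply: eq_integral => x _; rewrite -ge0_integralZl//.
      by apply: eq_integral => y _; rewrite normrM EFinM.
    by apply: measurableT_comp => //.
  rewrite ge0_integralZr//; last 2 first.
    by apply: measurableT_comp.
    by apply: integral_ge0.
  rewrite lte_mul_pinfty//; first exact: integral_ge0.
    have nX : (\int[DX]_y `|y%:E| < +oo)%E by case/integrableP : iDX.
    by rewrite ge0_fin_numE//; exact: integral_ge0.
have iP : P.-integrable setT (EFin \o (fun t => X t * Y t)).
  apply/integrableP; split; first exact/measurable_EFinP.
  have mF' : measurable_fun setT (fun z : R * R => `|(z.1 * z.2)%:E|%E).
    exact: measurableT_comp.
  have := @ge0_integral_pushforward _ _ _ _ _ Z mZ P setT _ measurableT mF' (fun _ _ => abse_ge0 _).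
  rewrite preimage_setT => <-.
  rewrite -(eq_measure_integral DZ (m1 := (DX \x DY)%E)).
    by case/integrableP : iF.
  by move=> S mS _; exact: DZE.
split => //.
have := @integral_pushforward _ _ _ _ _ Z mZ P setT _ mF iP measurableT.
rewrite preimage_setT => <-.
rewrite -(eq_measure_integral DZ (m1 := (DX \x DY)%E)); last first.
  by move=> S mS _; exact: DZE.
rewrite -integral12_prod_meas1// /fubini_F /=.
under eq_integral => x _ do under eq_integral do rewrite EFinM.
under eq_integral => x _ do rewrite integralZl// EDY.
by rewrite integralZr// EDX.
Qed.

(* Two applications of the pi-lambda theorem: first in A for B in the pi-system H, then in B. *)
Lemma indep_sigma_algebra G H : setI_closed G -> setI_closed H ->
  G setT -> H setT -> G `<=` measurable -> H `<=` measurable ->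
  (forall A B, G A -> H B -> P (A `&` B) = P A * P B)%E ->
  forall A B, <<s G >> A -> <<s H >> B -> (P (A `&` B) = P A * P B)%E.
Proof.
have half G0 B : setI_closed G0 -> G0 setT -> G0 `<=` measurable -> measurable B ->
    (forall A, G0 A -> P (A `&` B) = P A * P B)%E ->
    forall A, <<s G0 >> A -> (P (A `&` B) = P A * P B)%E.
  move=> GI GT Gm mB GB A sA.
  have PB0 : 0 <= fine (P B) by rewrite fine_ge0.
  have PBE : P B = (fine (P B))%:E by rewrite fineK// fin_num_measure.
  (* For fixed [B], the two finite measures compared are [P] restricted to [B] and [P] scaled by
     [P B]. *)
  have := @g_sigma_algebra_measure_unique _ R _ G0 Gm (fun=> setT) (fun=> GT) _
    (mrestr P mB) (mscale (NngNum PB0) P) GI _ _ A sA.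
  rewrite /= /mrestr/mscale/= -PBE muleC; apply.
  - by rewrite bigcup_const//; exists 0%N.
  - by move=> C GC; rewrite muleC; exact: GB.
  - move=> _; rewrite setTI.
    by rewrite (le_lt_trans (probability_le1 P mB))// ltry.
move=> GI HI GT HT Gm Hm GH A B sA sB.
have sm G0 : G0 `<=` measurable -> <<s G0 >> `<=` (measurable : set (set T)).
  exact: smallest_sub (@sigma_algebra_measurable _ T).
apply: (half G) sA => //; first exact: sm sB.
move=> {}A GA; rewrite setIC muleC; apply: (half H) sB => //; first exact: Gm.
by move=> {}B HB; rewrite setIC muleC; exact: GH.
Qed.

(** Typing [X] on [g_sigma_algebraType G] expresses that [X] depends only on the information in [G];
    independence of the generators is thus inherited by any such variables. *)
Lemma indep_rv_sigma_algebra G H X Y : setI_closed G -> setI_closed H ->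
  G setT -> H setT -> G `<=` measurable -> H `<=` measurable ->
  (forall A B, G A -> H B -> P (A `&` B) = P A * P B)%E ->
  measurable_fun setT (X : g_sigma_algebraType G -> R) ->
  measurable_fun setT (Y : g_sigma_algebraType H -> R) ->
  indep_rv X Y.
Proof.
move=> GI HI GT HT Gm Hm GH mX mY A B mA mB.
apply: (indep_sigma_algebra G H) => //.
  by have := mX measurableT A mA; rewrite setTI.
by have := mY measurableT B mB; rewrite setTI.
Qed.

(* The pi-system generating the sigma-algebra of U_0, ..., U_(n-1). *)
Definition cylinders (U : nat -> T -> R) n : set (set T) :=
  [set A | exists2 B : nat -> set R, (forall j, measurable (B j)) &
     A = \bigcap_(j < n) (U j @^-1` B j)].

Lemma cylinders_setI U n : setI_closed (cylinders U n).
Proof.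
move=> _ _ [B mB ->] [C mC ->]; exists (fun j => B j `&` C j).
  by move=> j; exact: measurableI.
by rewrite -bigcapI; apply: eq_bigcapr => j _; rewrite preimage_setI.
Qed.

Lemma cylinders_setT U n : cylinders U n setT.
Proof. by exists (fun=> setT) => //; apply/esym/bigcapT => ? ?. Qed.

Lemma cylinders_measurable U n : (forall j, measurable_fun setT (U j)) ->
  cylinders U n `<=` measurable.
Proof.
move=> mU _ [B mB ->]; apply: fin_bigcap_measurable => // j _.
by rewrite -[X in measurable X]setTI; exact: mU.
Qed.

Lemma cylinders_measurable_fun U n j : (j < n)%N ->
  measurable_fun setT (U j : g_sigma_algebraType (cylinders U n) -> R).
Proof.
move=> jn _ A mA; rewrite setTI; apply: sub_sigma_algebra.
exists (fun k => if k == j then A else setT) => [k|]; first by case: ifP.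
apply/seteqP; split=> [t tA k _ /=|t /(_ j jn)/=]; last by rewrite eqxx.
by case: ifPn => // /eqP ->.
Qed.

End independence.

(** * Moments of normal laws *)

Section normal_moments.
Context {R : realType}.
Local Notation mu := (@lebesgue_measure R).

(** The Radon-Nikodym derivative of the normal law and the explicit density have the same integral
    over every measurable set, hence agree almost everywhere. *)
Lemma ge0_integral_normal_prob (m s : R) (f : R -> \bar R) :
  measurable_fun setT f -> (forall x, 0 <= f x)%E ->
  (\int[normal_prob m s]_x f x = \int[mu]_x (f x * (normal_pdf m s x)%:E))%E.
Proof.
move=> mf f0; have dom := normal_prob_dominates m s.
have mpdf : measurable_fun setT (fun x : R => (normal_pdf m s x)%:E).
  by apply/measurable_EFinP; exact: measurable_normal_pdf.
have iRN := Radon_Nikodym_SigmaFinite.f_integrable dom.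
rewrite -(Radon_Nikodym_SigmaFinite.change_of_variables dom)//.
apply: ae_eq_integral => //.
- by apply: emeasurable_funM => //; exact: measurable_int iRN.
- exact: emeasurable_funM.
- apply: ae_eqe_mul2l; apply: integral_ae_eq => // E _ mE.
  by rewrite -Radon_Nikodym_SigmaFinite.f_integral.
Qed.

Lemma integral_normal_prob (m s : R) (f : R -> R) :
  mu.-integrable setT (fun x => (f x * normal_pdf m s x)%:E) ->
  measurable_fun setT f ->
  (normal_prob m s).-integrable setT (EFin \o f) /\
  (\int[normal_prob m s]_x (f x)%:E = \int[mu]_x (f x * normal_pdf m s x)%:E)%E.
Proof.
move=> ifp mf.
have p0 x := normal_pdf_ge0 m s x.
have mn : measurable_fun setT (fun x => `|f x|) by exact: measurableT_comp.
have mp : measurable_fun setT (fun x : R => normal_pdf m s x).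
  exact: measurable_normal_pdf.
have Nn : (\int[normal_prob m s]_x `|f x|%:E =
    \int[mu]_x `|(f x * normal_pdf m s x)%:E|)%E.
  rewrite ge0_integral_normal_prob//; last by apply/measurable_EFinP.
  by apply: eq_integral => x _; rewrite -EFinM /= normrM (ger0_norm (p0 x)).
have iN : (normal_prob m s).-integrable setT (EFin \o f).
  apply/integrableP; split; first exact/measurable_EFinP.
  by rewrite /= Nn; case/integrableP : ifp.
split => //.
have iNn : (normal_prob m s).-integrable setT (fun x => `|f x|%:E).
  exact: integrable_abse iN.
have inp : mu.-integrable setT (fun x => (`|f x| * normal_pdf m s x)%:E).
  have := integrable_abse ifp; apply: eq_integrable => // x _ /=.
  by rewrite normrM (ger0_norm (p0 x)).
(* Writing [f] as [|f| - (|f| - f)] reduces the signed case to two nonnegative integrable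
   functions. *)
have -> : (\int[normal_prob m s]_x (f x)%:E =
    \int[normal_prob m s]_x (`|f x|%:E - (`|f x| - f x)%:E))%E.
  by apply: eq_integral => x _; rewrite -EFinB; congr EFin; ring.
have -> : (\int[mu]_x (f x * normal_pdf m s x)%:E =
    \int[mu]_x ((`|f x| * normal_pdf m s x)%:E - ((`|f x| - f x) * normal_pdf m s x)%:E))%E.
  by apply: eq_integral => x _; rewrite -EFinB; congr EFin; ring.
rewrite integralB//; last first.
  have := integrableB measurableT iNn iN.
  by apply: eq_integrable.
rewrite integralB//; last first.
  have := integrableB measurableT inp ifp.
  by apply: eq_integrable => // x _; rewrite /= -EFinB; congr EFin; ring.
congr (_ - _)%E.
  rewrite ge0_integral_normal_prob//; exact/measurable_EFinP.
rewrite ge0_integral_normal_prob//.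
  by apply/measurable_EFinP; exact: measurable_funB.
by move=> x; rewrite lee_fin subr_ge0 ler_norm.
Qed.

Lemma exprn_le_expR (p : nat) (y : R) : 0 <= y -> y ^+ p <= p`!%:R * expR y.
Proof.
move=> y0; case: p => [|p]; first by rewrite expr0 mul1r -[leLHS]expR0 ler_expR.
have := expR_ge1Dxn p y0.
have f0 : (0:R) < (p.+1)`!%:R by rewrite ltr0n fact_gt0.
move=> le; rewrite -ler_pdivrMl// mulrC; apply: le_trans le.
by rewrite lerDr.
Qed.

Variable s : R.
Hypothesis s0 : 0 < s.
Local Notation pdf := (normal_pdf 0 s).
Let sn0 : s != 0. Proof. by rewrite gt_eqF. Qed.

(** Doubling the standard deviation frees a factor [exp y] with [y = 3 x^2 / (8 s^2)], which absorbs
    the power through [|x|^p <= 1 + x^(2p)] and [y^p <= p! exp y]; hence [8 / 3] and [K]. The wider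
    density is integrable and bounded: one property gives integrable moments, the other vanishing
    boundary terms. *)
Lemma exprn_normal_pdf_le (p : nat) :
  exists2 C, 0 <= C & forall x, `|x| ^+ p * pdf x <= C * normal_pdf 0 (2 * s) x.
Proof.
pose K : R := 1 + (8 / 3 * s ^+ 2) ^+ p * p`!%:R.
exists (K * normal_peak s / normal_peak (2 * s)) => [|x].
  rewrite mulr_ge0 ?invr_ge0 ?normal_peak_ge0// mulr_ge0 ?normal_peak_ge0//.
  by rewrite addr_ge0// mulr_ge0// exprn_ge0// mulr_ge0// sqr_ge0.
have s20 : 2 * s != 0 by rewrite mulf_neq0.
rewrite !normal_pdfE// /normal_fun !subr0.
rewrite mulrCA [leRHS]mulrA divfK ?gt_eqF ?normal_peak_gt0// [K * _]mulrC -mulrA.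
apply: ler_wpM2l; first exact: normal_peak_ge0.
pose y := x ^+ 2 / (8 / 3 * s ^+ 2).
have y0 : 0 <= y by rewrite mulr_ge0 ?sqr_ge0// invr_ge0 mulr_ge0// sqr_ge0.
have -> : - x ^+ 2 / ((2 * s) ^+ 2 *+ 2) = - x ^+ 2 / (s ^+ 2 *+ 2) + y.
  by rewrite /y; field.
rewrite expRD mulrCA mulrC ler_wpM2l ?expR_ge0//.
have xy : `|x| ^+ (2 * p) = (8 / 3 * s ^+ 2) ^+ p * y ^+ p.
  rewrite exprM real_normK ?num_real// -exprMn /y; congr (_ ^+ _); by field.
have xp : `|x| ^+ p <= 1 + `|x| ^+ (2 * p).
  by rewrite mulnC exprM; set z := _ ^+ p; nra.
apply: (le_trans xp); rewrite mulrDl mul1r; apply: lerD.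
  by rewrite -[leLHS]expR0 ler_expR.
rewrite xy -[leRHS]mulrA; apply: ler_wpM2l; last exact: exprn_le_expR.
by rewrite exprn_ge0// mulr_ge0// sqr_ge0.
Qed.

Lemma integrable_exprn_normal_pdf (p : nat) :
  mu.-integrable setT (fun x => (x ^+ p * pdf x)%:E).
Proof.
have [C _ hC] := exprn_normal_pdf_le p.
have := integrableZl measurableT C (integrable_normal_pdf 0 (2 * s)).
apply: le_integrable => //.
  apply/measurable_EFinP; apply: measurable_funM; first exact: measurable_funX.
  exact: measurable_normal_pdf.
move=> x _; rewrite /= lee_fin normrM normrX (ger0_norm (normal_pdf_ge0 _ _ _)).
by rewrite (le_trans (hC x))// ler_norm.
Qed.

(** Gaussian integration by parts: [pdf' = - x / s^2 * pdf], so [F p] is a primitive of [f p]. At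
    [p = 0] the term with [p.-1] has coefficient 0. *)
Let F (p : nat) (x : R) : R := - s ^+ 2 * (x ^+ p * pdf x).
Let f (p : nat) (x : R) : R := (x ^+ p.+1 - p%:R * s ^+ 2 * x ^+ p.-1) * pdf x.

Let is_derive_F p (x : R) : is_derive x 1 (F p) (f p x).
Proof.
have dpdf : is_derive x 1 pdf (- x / s ^+ 2 * pdf x).
  have -> : pdf = (fun x => normal_peak s * normal_fun 0 s x).
    by apply/funext => y; rewrite normal_pdfE.
  have -> : normal_fun 0 s = expR \o (fun z => - (2 * s ^+ 2)^-1 * z ^+ 2).
    by apply/funext => y; rewrite /normal_fun /= subr0; congr expR; field.
  by apply: is_derive_eq; rewrite /= /GRing.scale/=; field.
have dX : is_derive x 1 (fun y : R => y ^+ p) (p%:R * x ^+ p.-1).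
  have := @is_deriveX R R id p x 1 1 (is_derive_id _ _).
  by rewrite /GRing.scale/= mulr1 exprfctE.
have := is_deriveZ (- s ^+ 2) (is_deriveM dX dpdf).
rewrite /F /f /GRing.scale/= => FF; apply: (is_derive_eq FF).
by rewrite [x ^+ p.+1]exprS; move: (x ^+ p) (x ^+ p.-1) => u w; field.
Qed.

(* Integrates the derivative f p of F p over [-n, n]; the boundary terms are O(1/n). *)
Lemma normal_pdf_recurrence (p : nat) :
  (\int[mu]_x (x ^+ p.+1 * pdf x)%:E =
   (p%:R * s ^+ 2)%:E * \int[mu]_x (x ^+ p.-1 * pdf x)%:E)%E.
Proof.
have i1 := integrable_exprn_normal_pdf p.+1.
have i0 := integrable_exprn_normal_pdf p.-1.
have iZ := integrableZl measurableT (p%:R * s ^+ 2) i0.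
have fE x : (f p x)%:E = ((x ^+ p.+1 * pdf x)%:E - (p%:R * s ^+ 2)%:E * (x ^+ p.-1 * pdf x)%:E)%E.
  by rewrite -EFinM -EFinB; congr EFin; rewrite /f; ring.
have iff : mu.-integrable setT (EFin \o f p).
  by apply: eq_integrable (integrableB measurableT i1 iZ) => // x _ /=.
suff f0 : (\int[mu]_x (f p x)%:E = 0)%E.
  have [u1 E1] : exists u, (\int[mu]_x (x ^+ p.+1 * pdf x)%:E = u%:E)%E.
    by exists (fine (\int[mu]_x (x ^+ p.+1 * pdf x)%:E)); rewrite fineK// integrable_fin_num.
  have [u0 E0] : exists u, (\int[mu]_x (x ^+ p.-1 * pdf x)%:E = u%:E)%E.
    by exists (fine (\int[mu]_x (x ^+ p.-1 * pdf x)%:E)); rewrite fineK// integrable_fin_num.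
  move: f0; under eq_integral do rewrite fE.
  rewrite integralB// integralZl// E1 E0 -EFinM -EFinB => -[] /eqP.
  by rewrite subr_eq0 => /eqP ->.
pose D n : set R := `[- n.+1%:R, n.+1%:R]%classic.
(* The bound is taken at order [p + 1] although [F p] has order [p]: the spare factor [|y| = n + 1]
   gives the decay. *)
have [C C0 hC] := exprn_normal_pdf_le p.+1.
pose K := s ^+ 2 * (C * normal_peak (2 * s)).
have FK n (y : R) : `|y| = n.+1%:R -> `|F p y| <= K * n.+1%:R^-1.
  move=> yn; rewrite /F normrM normrN (ger0_norm (sqr_ge0 _)) /K -mulrA.
  apply: ler_wpM2l; first exact: sqr_ge0.
  rewrite ler_pdivlMr ?ltr0n// normrM normrX (ger0_norm (normal_pdf_ge0 _ _ _)).
  rewrite mulrAC -yn -exprSr (le_trans (hC _))// ler_wpM2l// normal_pdf_ub//.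
  by rewrite mulf_neq0.
have gE n : (\int[mu]_x (((EFin \o f p) \_ (D n)) x) = (F p n.+1%:R - F p (- n.+1%:R))%:E)%E.
  have n0 : - n.+1%:R < n.+1%:R :> R by rewrite gtrN// ltr0n.
  rewrite -integral_mkcond EFinB; apply: (continuous_FTC2 n0).
  - apply: continuous_subspaceT => x.
    apply: cvgM; last exact: continuous_normal_pdf.
    apply: cvgB; first exact: exprn_continuous.
    by apply: cvgMr; exact: exprn_continuous.
  - have dF x : derivable (F p) x 1 by case: (is_derive_F p x).
    have cF : continuous (F p).
      by move=> x; exact/differentiable_continuous/derivable1_diffP.
    split => //.
    + by apply: cvg_at_right_filter; exact: cF.
    + by apply: cvg_at_left_filter; exact: cF.
  - by move=> x _; rewrite derive1E; case: (is_derive_F p x).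
have gcvg : (\int[mu]_x (((EFin \o f p) \_ (D n)) x) @[n --> \oo] --> \int[mu]_x (f p x)%:E)%E.
  have [|||||_ _ //] := @dominated_convergence _ _ _ mu setT measurableT
    (fun n => (EFin \o f p) \_ (D n)) (EFin \o f p) (fun x => `|(f p x)%:E|%E).
  - move=> n; apply/measurable_restrict => //; first exact: measurable_itv.
    by rewrite setTI; apply: measurable_funTS; exact: measurable_int iff.
  - exact: measurable_int iff.
  - apply: nearW => x _; apply: cvg_near_cst.
    exists (Num.truncn `|x|) => // k /= kx; rewrite patchE mem_set//.
    rewrite /D /= in_itv/= -ler_norml ltW//.
    by apply: lt_le_trans (truncnS_gt _) _; rewrite ler_nat ltnS.
  - exact: integrable_abse iff.
  - by apply: nearW => x n _; rewrite patchE; case: ifP => //; rewrite abse0.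
rewrite -(cvg_lim _ gcvg)//; apply/cvg_lim => //.
under eq_fun do rewrite gE.
apply: cvg_EFin; first exact: nearW.
apply: (@squeeze_cvgr _ _ _ _ (fun n => - (2 * K * n.+1%:R^-1)) (fun n => 2 * K * n.+1%:R^-1)).
- apply: nearW => n; rewrite -ler_norml (le_trans (ler_normB _ _))//.
  rewrite (_ : 2 * K * _ = K * n.+1%:R^-1 + K * n.+1%:R^-1); last by ring.
  by rewrite lerD// FK// ?normrN normr_nat.
- rewrite -oppr0 -(mulr0 (2 * K)); apply: cvgN; apply: cvgMr; exact: cvg_harmonic.
- rewrite -(mulr0 (2 * K)); apply: cvgMr; exact: cvg_harmonic.
Qed.

(** Moments of the centred normal law of variance [v], that is [(p-1)!! v^(p/2)] for even [p] and 0
    for odd [p]. At [v = 0] these are the moments of the constant 0, the starting value of the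
    scheme. *)
Fixpoint gauss_moment (v : R) (p : nat) : R :=
  match p with
  | 0 => 1
  | 1 => 0
  | (q.+1 as p').+1 => p'%:R * v * gauss_moment v q
  end.

Lemma integral_exprn_normal_pdf (p : nat) :
  (\int[mu]_x (x ^+ p * pdf x)%:E = (gauss_moment (s ^+ 2) p)%:E)%E.
Proof.
have [n] := ubnP p; elim: n p => // n IH [|[|p]] /= pn.
- under eq_integral do rewrite expr0 mul1r.
  exact: integral_normal_pdf.
- by rewrite normal_pdf_recurrence mul0r mul0e.
- by rewrite normal_pdf_recurrence /= IH ?EFinM//; exact: (ltnW (n := n)).
Qed.

End normal_moments.

(** * Random variables with Gaussian moments, and their independent sums *)

Section gauss_moments.
Context {d : measure_display} {T : measurableType d} {R : realType}.
Variable P : probability T R.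
Implicit Types (X Y : T -> R) (v : R).

(* Order 8 is what bounds the second moment of a product of two squares. *)
Definition has_gauss_moments X v :=
  forall p, (p <= 8)%N -> has_mean P (fun t => X t ^+ p) (gauss_moment v p).

Lemma normal_has_gauss_moments X v : 0 < v -> measurable_fun setT X ->
  (forall B, measurable B -> P (X @^-1` B) = normal_prob 0 (Num.sqrt v) B) ->
  has_gauss_moments X v.
Proof.
move=> v0 mX PX p _.
have s0 : 0 < Num.sqrt v by rewrite sqrtr_gt0.
have mp : measurable_fun setT (fun x : R => x ^+ p) by exact: measurable_funX.
have mpE : measurable_fun setT (fun x : R => (x ^+ p)%:E) by exact/measurable_EFinP.
have mXp : measurable_fun setT (fun t => X t ^+ p) by exact: measurable_funX.
have [iN EN] := integral_normal_prob 0 _ _ (integrable_exprn_normal_pdf _ s0 p) mp.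
pose X' : {mfun T >-> measurableTypeR R} :=
  HB.pack X (isMeasurableFun.Build _ _ T (measurableTypeR R) X mX).
have DN (f : R -> \bar R) : (\int[distribution P X']_x f x =
    \int[normal_prob 0 (Num.sqrt v)]_x f x)%E.
  by apply: eq_measure_integral => A mA _; rewrite /= -PX.
have iX : P.-integrable setT (EFin \o (fun t => X t ^+ p)).
  apply/integrableP; split; first exact/measurable_EFinP.
  have mF : measurable_fun setT (fun x : R => `|(x ^+ p)%:E|%E) by exact: measurableT_comp.
  have := @ge0_integral_pushforward _ _ _ (measurableTypeR R) _ X mX P setT _ measurableT mF
    (fun _ _ => abse_ge0 _).
  rewrite preimage_setT => <-.
  by rewrite [X in (X < _)%E]DN; case/integrableP : iN.
split => //.
have := @integral_pushforward _ _ _ (measurableTypeR R) _ X mX P setT _ mpE iX measurableT.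
rewrite preimage_setT => <-.
rewrite [LHS]DN EN integral_exprn_normal_pdf//.
by rewrite sqr_sqrtr// ltW.
Qed.

(** The binomial formula and independence reduce stability of Gaussian moments to a polynomial
    identity in [r], [v] and [w]. *)
Lemma has_gauss_moments_add X Y v w (r : R) : indep_rv P X Y ->
  has_gauss_moments X v -> has_gauss_moments Y w ->
  has_gauss_moments (fun t => r * X t + Y t) (r ^+ 2 * v + w).
Proof.
move=> XY gX gY p p8.
apply: (@has_mean_eq _ _ _ P (fun t => \sum_(i < p.+1)
   (r ^+ (p - i) *+ 'C(p, i)) * (X t ^+ (p - i) * Y t ^+ i)) _
   (\sum_(i < p.+1) (r ^+ (p - i) *+ 'C(p, i)) *
     (gauss_moment v (p - i) * gauss_moment w i))).
- move=> t; rewrite exprDn; apply: eq_bigr => i _.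
  by rewrite exprMn mulrnAl -mulrA.
(* The identity is checked separately for each order from 0 to 8; evaluating binomials and indices
   leaves a goal for [ring]. *)
- case: p p8 => [|[|[|[|[|[|[|[|[|p]]]]]]]]] // _;
  rewrite !big_ord_recl big_ord0;
  cbn [nat_of_ord lift ord0 gauss_moment];
  repeat match goal with |- context [binomial ?n ?m] =>
    let c := eval vm_compute in (binomial n m) in change (binomial n m) with c end;
  repeat match goal with |- context [subn ?n ?m] =>
    let c := eval vm_compute in (subn n m) in change (subn n m) with c end;
  repeat match goal with |- context [bump ?n ?m] =>
    let c := eval vm_compute in (bump n m) in change (bump n m) with c end;
  cbn [gauss_moment]; ring.
- apply: has_mean_sum => i; apply: has_meanZ; apply: has_meanM.
  + apply: (indep_rv_comp _ X Y (fun x => x ^+ (p - i)) (fun x => x ^+ i)) => //;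
    exact: measurable_funX.
  + by apply: gX; rewrite (leq_trans (leq_subr _ _)).
  + by apply: gY; rewrite (leq_trans _ p8)// -ltnS.
Qed.

End gauss_moments.

(** * The Euler scheme along a path *)

Section euler_scheme.
Context {R : realType}.
Local Notation mu := (@lebesgue_measure R).
Implicit Types (r a x h e : R) (D : nat -> R) (f g : R -> R).

Fixpoint euler r D (j : nat) : R :=
  if j is i.+1 then r * euler r D i + D i else 0.

(** Heine-Cantor, through the near-covering form of compactness: a modulus valid around each point
    of the segment is valid on all of it. *)
Lemma segment_unif_continuous f (T e : R) : 0 < e ->
  {within `[0, T]%classic, continuous f} ->
  exists2 d0, 0 < d0 & forall x y, x \in `[0, T] -> y \in `[0, T] ->
    `|y - x| < d0 -> `|f y - f x| < e.
Proof.
move=> e0 cf.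
have /compact_near_coveringP ncov := @segment_compact R 0 T.
pose Q (d : R) x := x \in `[0, T] -> forall y, y \in `[0, T] -> `|y - x| < d -> `|f y - f x| < e.
have Qloc x : `[0, T]%classic x -> \forall x' \near x & d \near 0^'+, Q d x'.
  move=> xT.
  have /subspace_continuousP/(_ x xT)/cvgrPdist_lt := cf.
  move=> /(_ (e / 2)) [|d d0 fd]; first by rewrite divr_gt0.
  have d0' : 0 < d by exact: d0.
  have {}fd y : y \in `[0, T] -> `|x - y| < d -> `|f x - f y| < e / 2.
    by move=> yT xyd; apply: fd => //; rewrite /ball/= .
  exists ([set x' | `|x - x'| < d / 2], [set d' : R | d' < d / 2]) => /=.
    split; first by exists (d / 2) => //=; rewrite divr_gt0.
    by apply: nbhs_right_lt; rewrite divr_gt0.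
  move=> [x' d'] /= [xx' dd'] x'T y yT yx'.
  have h1 : `|f x - f x'| < e / 2 by apply: fd => //; lra.
  have h2 : `|f x - f y| < e / 2.
    apply: fd => //; rewrite (_ : x - y = (x - x') - (y - x')); last by ring.
    by rewrite (le_lt_trans (ler_normB _ _))//; lra.
  rewrite (_ : f y - f x' = (f x - f x') - (f x - f y)); last by ring.
  by rewrite (le_lt_trans (ler_normB _ _))//; lra.
have near : \forall d \near (0 : R)^'+, `[0, T]%classic `<=` Q d by exact: ncov.
have gt0 : \forall d \near (0 : R)^'+, 0 < d by exact: nbhs_right_gt.
have [d [d0 Qd]] := filter_ex (filterI gt0 near).
exists d => // x y xT yT; exact: Qd.
Qed.

Lemma euler_step_error f (t d e : R) : 0 <= t -> 0 < d ->
  {within `[0, t + d]%classic, continuous f} ->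
  (forall s, t <= s <= t + d -> `|f s - f t| <= e) ->
  `|\int[mu]_(s in `[0, t + d]) f s - \int[mu]_(s in `[0, t]) f s - d * f t| <= d * e.
Proof.
move=> t0 d0 cf fe.
have i0 : mu.-integrable `[0, t + d] (EFin \o f).
  by apply: continuous_compact_integrable => //; exact: segment_compact.
have sub : `]t, t + d] `<=` `[0, t + d].
  by move=> s /=; rewrite !in_itv/= => /andP[ts ->]; rewrite andbT; lra.
have i1 : mu.-integrable `]t, t + d] (EFin \o f) by exact: integrableS i0.
rewrite Rintegral_itvB//; last by rewrite bnd_simp lerDl ltW.
have len c : \int[mu]_(s in `]t, t + d]) c = c * d.
  have muE : mu `]t, t + d]%classic = d%:E.
    by rewrite lebesgue_measure_itv/= lte_fin ltrDl d0 -EFinB addrAC subrr add0r.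
  rewrite Rintegral_cst//; congr (_ * _); exact: (congr1 fine muE).
have ic c : mu.-integrable `]t, t + d] (EFin \o (fun=> c)).
  apply: (@integrableS _ _ _ mu `[t, t + d]) => //.
    by move=> s /=; rewrite !in_itv/= => /andP[/ltW -> ->].
  apply: continuous_compact_integrable; first exact: segment_compact.
  by apply: continuous_subspaceT => ?; exact: cvg_cst.
have bnd s : `]t, t + d]%classic s -> `|f s - f t| <= e.
  by rewrite /= in_itv/= => /andP[/ltW ts sd]; apply: fe; rewrite ts sd.
have up : \int[mu]_(s in `]t, t + d]) f s <= (f t + e) * d.
  rewrite -len; apply: le_Rintegral => // s /bnd; rewrite ler_norml => /andP[_]; lra.
have lo : (f t - e) * d <= \int[mu]_(s in `]t, t + d]) f s.
  rewrite -len; apply: le_Rintegral => // s /bnd; rewrite ler_norml => /andP[+ _]; lra.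
move: up lo; move: (Rintegral _ _ _) (f t) => I u; clear => up lo.
by rewrite ler_norml; apply/andP; split; lra.
Qed.

(** The scheme uses the true increments of [g], so the noise cancels: each step multiplies the error
    by [1 + a d], of absolute value at most 1, and adds [a] times a quadrature error of size at most
    [d e]. *)
Lemma euler_error f g a sigma (d e : R) m : 0 < d -> -1 <= 1 + a * d <= 1 ->
  f 0 = 0 ->
  {within `[0, m%:R * d]%classic, continuous f} ->
  (forall t, 0 <= t -> f t = a * \int[mu]_(s in `[0, t]) f s + sigma * g t) ->
  (forall s t, s \in `[0, m%:R * d] -> t \in `[0, m%:R * d] -> `|t - s| <= d -> `|f t - f s| <= e) ->
  forall j, (j <= m)%N ->
  `|f (j%:R * d) - sigma * euler (1 + a * d) (fun i => g (i.+1%:R * d) - g (i%:R * d)) j|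
    <= j%:R * (`|a| * (d * e)).
Proof.
move=> d0 /andP[rl rr] f0 cf fE fe; elim=> [_|j IH jm].
  by rewrite !mul0r f0 mulr0 subrr normr0.
rewrite /=; set Y := euler _ _ _ in IH *.
have jd0 : 0 <= j%:R * d by rewrite mulr_ge0// ltW.
have jS : j.+1%:R * d = j%:R * d + d by rewrite -natr1 mulrDl mul1r.
have jSm : j%:R * d + d <= m%:R * d by rewrite -jS ler_pM2r// ler_nat.
have cfj : {within `[0, j%:R * d + d]%classic, continuous f}.
  by apply: continuous_subspaceW cf => s /=; rewrite !in_itv/= => /andP[-> /= ?]; lra.
have fej s : j%:R * d <= s <= j%:R * d + d -> `|f s - f (j%:R * d)| <= e.
  move=> /andP[js sj]; apply: fe; rewrite ?in_itv/=; [lra|lra|].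
  by rewrite ger0_norm; lra.
have err := euler_step_error _ _ _ _ jd0 d0 cfj fej.
set I1 := Rintegral _ _ _ in err; set I0 := Rintegral _ _ _ in err.
have E1 : f (j.+1%:R * d) = a * I1 + sigma * g (j.+1%:R * d).
  by rewrite fE ?jS// addr_ge0// ltW.
have E0 : f (j%:R * d) = a * I0 + sigma * g (j%:R * d) by rewrite fE.
rewrite (_ : f (j.+1%:R * d) - _ = (1 + a * d) * (f (j%:R * d) - sigma * Y) +
    a * (I1 - I0 - d * f (j%:R * d))); last first.
  by rewrite E1 [in RHS]mulrBr; move: E0; set u := f (j%:R * d) => E0; nra.
rewrite (le_trans (ler_normD _ _))// -[j.+1%:R]natr1 [leRHS]mulrDl mul1r lerD//; last first.
  by rewrite normrM ler_wpM2l.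
rewrite normrM; apply: le_trans (IH (ltnW jm)).
by rewrite ler_piMl// ler_norml rl rr.
Qed.

(** Squeeze with [y = x / (n+1)]: [exp (y / (1+y)) <= 1 + y <= exp y], the left bound being
    [1 + z <= exp z] at [z = - y / (1+y)], inverted. *)
Lemma cvg_one_plus_div x :
  (1 + x / n.+1%:R) ^+ n.+1 @[n --> \oo] --> expR x.
Proof.
have x0 : x / n.+1%:R @[n --> \oo] --> 0.
  by rewrite -[X in _ --> X](mulr0 x); apply: cvgMr; exact: cvg_harmonic.
have pos : \forall n \near \oo, 0 < 1 + x / n.+1%:R.
  have : 1 + x / n.+1%:R @[n --> \oo] --> (1 + 0 : R) by apply: cvgD => //; exact: cvg_cst.
  rewrite addr0 => /cvgrPdist_lt/(_ 1 ltr01); apply: filterS => n.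
  by move: (x / _) => y; rewrite ltr_norml => /andP[_]; lra.
apply: (@squeeze_cvgr _ _ _ _ (fun n => expR (x / (1 + x / n.+1%:R))) (fun=> expR x)).
- apply: filterS pos => n p0; set y := x / n.+1%:R in p0 *.
  have n0 : n.+1%:R != 0 :> R by [].
  have xE : x = y * n.+1%:R by rewrite /y divfK.
  apply/andP; split.
    have -> : x / (1 + y) = n.+1%:R * (y / (1 + y)).
      by rewrite {1}xE; field; rewrite gt_eqF.
    rewrite expRM_natl ler_pXn2r// ?nnegrE ?expR_ge0//; last exact: ltW.
    rewrite -[leRHS]invrK -[leLHS]invrK lef_pV2 ?posrE ?invr_gt0 ?expR_gt0//.
    rewrite -expRN; apply: le_trans (expR_ge1Dx _).
    rewrite le_eqVlt; apply/orP; left; apply/eqP; field; rewrite gt_eqF//.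
  rewrite [in leRHS]xE mulrC expRM_natl ler_pXn2r// ?nnegrE ?expR_ge0//; last exact: ltW.
  exact: expR_ge1Dx.
- apply: continuous_cvg; first exact: continuous_expR.
  rewrite -[X in _ --> X]divr1; apply: cvgM; first exact: cvg_cst.
  apply: cvgV => //; rewrite -[X in _ --> X]addr0.
  by apply: cvgD => //; exact: cvg_cst.
- exact: cvg_cst.
Qed.

Lemma euler_cvg f g a sigma h k : a < 0 -> 0 < h ->
  {within `[0, +oo[%classic, continuous f} -> g 0 = 0 ->
  (forall t, 0 <= t -> f t = a * \int[mu]_(s in `[0, t]) f s + sigma * g t) ->
  sigma * euler (1 + a * (h / n.+1%:R))
    (fun i => g (i.+1%:R * (h / n.+1%:R)) - g (i%:R * (h / n.+1%:R))) (k * n.+1)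
    @[n --> \oo] --> f (k%:R * h).
Proof.
move=> a0 h0 cf g0 fE.
have f0 : f 0 = 0.
  by rewrite fE// set_itv1 Rintegral_set1 g0 !mulr0 addr0.
have cfT : {within `[0, k%:R * h]%classic, continuous f}.
  by apply: continuous_subspaceW cf => s /=; rewrite !in_itv/= => /andP[->].
apply/cvgrPdist_le => e e0.
(* The accumulated error is [k h |a|] times the modulus; adding 1 keeps [C] positive when
   [k = 0]. *)
pose C := k%:R * h * `|a| + 1.
have C0 : 0 < C by rewrite ltr_wpDl// mulr_ge0// mulr_ge0// ltW.
have [d0 d00 Hd] := @segment_unif_continuous f (k%:R * h) (e / C) (divr_gt0 e0 C0) cfT.
have hc : h / n.+1%:R @[n --> \oo] --> 0.
  by rewrite -[X in _ --> X](mulr0 h); apply: cvgMr; exact: cvg_harmonic.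
have near1 : \forall n \near \oo, h / n.+1%:R < d0.
  by move/cvgrPdist_lt : hc => /(_ _ d00); apply: filterS => n; rewrite sub0r normrN ltr_norml => /andP[].
have near2 : \forall n \near \oo, `|a| * (h / n.+1%:R) < 1.
  have : `|a| * (h / n.+1%:R) @[n --> \oo] --> `|a| * 0 by apply: cvgMr.
  rewrite mulr0 => /cvgrPdist_lt/(_ _ ltr01); apply: filterS => n.
  by rewrite sub0r normrN ltr_norml => /andP[].
near=> n.
have n1 : h / n.+1%:R < d0 by near: n.
have n2 : `|a| * (h / n.+1%:R) < 1 by near: n.
set d := h / n.+1%:R in n1 n2 *.
have dp : 0 < d by rewrite divr_gt0.
have kE : k%:R * h = (k * n.+1)%:R * d by rewrite natrM /d; field.
rewrite kE.
apply: le_trans (@euler_error f g a sigma d (e / C) (k * n.+1) dp _ f0 _ fE _ _ (leqnn _)) _.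
- by move: n2; rewrite ltr0_norm//; nra.
- by rewrite -kE.
- move=> s t sT tT st; apply/ltW/Hd; rewrite ?kE//; exact: le_lt_trans st n1.
- have CE : C - 1 = (k * n.+1)%:R * d * `|a| by rewrite /C kE addrK.
  rewrite (_ : (k * n.+1)%:R * (`|a| * (d * (e / C))) = (C - 1) / C * e); last first.
    by rewrite CE; field; rewrite gt_eqF.
  by apply: ler_piMl; [exact: ltW|rewrite ler_pdivrMr// mul1r; lra].
Unshelve. all: by end_near. Qed.

End euler_scheme.

(** * The Euler scheme driven by a Wiener process *)

Section wiener_increments.
Context {d : measure_display} {T : measurableType d} {R : realType}.
Variable P : probability T R.
Implicit Types (w : R -> T -> R) (D : nat -> T -> R) (r v : R).

Definition increment w (dt : R) (j : nat) (om : T) : R :=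
  w (j.+1%:R * dt) om - w (j%:R * dt) om.

Lemma measurable_increment w dt j : wiener_process P w ->
  measurable_fun setT (increment w dt j).
Proof. by move=> [mw _ _ _ _]; exact: measurable_funB. Qed.

Lemma increment_gauss_moments w dt j : 0 < dt -> wiener_process P w ->
  has_gauss_moments P (increment w dt j) dt.
Proof.
move=> dt0 W; apply: normal_has_gauss_moments => //; first exact: measurable_increment.
move=> B mB; have [_ _ _ lawW _] := W.
have j0 : 0 <= j%:R * dt by rewrite mulr_ge0// ltW.
have jS : j%:R * dt < j.+1%:R * dt by rewrite ltr_pM2r// ltr_nat.
have dE : j.+1%:R * dt - j%:R * dt = dt by rewrite -mulrBl -natrB// subSnn mul1r.
rewrite -[X in normal_prob _ (Num.sqrt X)]dE.
exact: (lawW _ _ j0 jS B mB).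
Qed.

Lemma increments_indep w dt n (B : nat -> set R) : 0 < dt -> wiener_process P w ->
  (forall j, measurable (B j)) ->
  P (\bigcap_(j < n) (increment w dt j @^-1` B j)) =
  (\prod_(j < n) P (increment w dt j @^-1` B j))%E.
Proof.
move=> dt0 [_ _ _ _ indW] mB; case: n => [|n].
  by rewrite big_ord0 bigcap_mkord big_ord0 probability_setT.
have := indW n (fun i : 'I_n.+2 => (i : nat)%:R * dt).
rewrite mul0r lexx => /(_ isT) /= /(_ _)/(_ (fun j => B j)) indep.
have -> : \bigcap_(j < n.+1) (increment w dt j @^-1` B j) =
   \bigcap_(j in [set: 'I_n.+1]) (increment w dt j @^-1` B j).
  apply/seteqP; split=> [t tB j _|t tB j jn]; first exact: (tB j (ltn_ord j)).
  exact: (tB (Ordinal jn)).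
apply: indep => // j; by rewrite ltr_pM2r// ltr_nat.
Qed.

(** The intersection is a cylinder over the first [j + 1] increments, whose probability factors. A
    constant sequence with length 1 encodes the sigma-algebra of the single increment [j]. *)
Lemma cylinders_increment_indep w dt j A B : 0 < dt -> wiener_process P w ->
  cylinders (increment w dt) j A -> cylinders (fun=> increment w dt j) 1 B ->
  (P (A `&` B) = P A * P B)%E.
Proof.
move=> dt0 W [C mC ->] [B' mB' ->].
pose E i := if i == j then B' 0%N else C i.
have mE i : measurable (E i) by rewrite /E; case: ifP.
have EC i : (i < j)%N -> E i = C i by move=> ij; rewrite /E ltn_eqF.
have -> : \bigcap_(i < j) (increment w dt i @^-1` C i) =
          \bigcap_(i < j) (increment w dt i @^-1` E i).
  by apply: eq_bigcapr => i /= ij; rewrite EC.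
have -> : \bigcap_(i < 1) (increment w dt j @^-1` B' i) = increment w dt j @^-1` E j.
  by rewrite bigcap_mkord big_ord1 /E eqxx.
have -> : \bigcap_(i < j) (increment w dt i @^-1` E i) `&` (increment w dt j @^-1` E j) =
          \bigcap_(i < j.+1) (increment w dt i @^-1` E i).
  by rewrite !bigcap_mkord big_ord_recr.
by rewrite !increments_indep// big_ord_recr.
Qed.

Definition euler_rv r D (j : nat) (om : T) : R := euler r (D ^~ om) j.

Lemma measurable_euler_rv G r D j :
  (forall i, (i < j)%N -> measurable_fun setT (D i : g_sigma_algebraType G -> R)) ->
  measurable_fun setT (euler_rv r D j : g_sigma_algebraType G -> R).
Proof.
elim: j => [_|j IH mD]; first exact: measurable_cst.
apply: measurable_funD; last exact: mD.
apply: measurable_funM; first exact: measurable_cst.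
by apply: IH => i ij; apply: mD; rewrite ltnS ltnW.
Qed.

Lemma indep_rv_increment w dt j (F : T -> R) : 0 < dt -> wiener_process P w ->
  measurable_fun setT (F : g_sigma_algebraType (cylinders (increment w dt) j) -> R) ->
  indep_rv P F (increment w dt j).
Proof.
move=> dt0 W mF.
have mI i : measurable_fun setT (increment w dt i) by exact: measurable_increment.
apply: (indep_rv_sigma_algebra P (cylinders (increment w dt) j)
   (cylinders (fun=> increment w dt j) 1)) => //.
- exact: cylinders_setI.
- exact: cylinders_setI.
- exact: cylinders_setT.
- exact: cylinders_setT.
- exact: cylinders_measurable.
- exact: cylinders_measurable.
- by move=> A B; exact: cylinders_increment_indep.
- exact: (cylinders_measurable_fun (fun=> increment w dt j) 1 0).
Qed.

Lemma measurable_euler_increment w dt r i j : (i <= j)%N ->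
  measurable_fun setT (euler_rv r (increment w dt) i
     : g_sigma_algebraType (cylinders (increment w dt) j) -> R).
Proof.
move=> ij; apply: measurable_euler_rv => k ki; apply: cylinders_measurable_fun.
exact: leq_trans ij.
Qed.

Fixpoint euler_var r v (j : nat) : R :=
  if j is i.+1 then r ^+ 2 * euler_var r v i + v else 0.

Lemma euler_gauss_moments w dt r j : 0 < dt -> wiener_process P w ->
  has_gauss_moments P (euler_rv r (increment w dt) j) (euler_var r dt j).
Proof.
move=> dt0 W; elim: j => [|j IH].
  move=> p p8; apply: has_mean_eq (has_mean_cst P (gauss_moment 0 p)) => // t.
  rewrite /euler_rv /=; case: p {p8} => [|[|p]]; rewrite ?expr0//.
  by rewrite /= mulr0 mul0r expr0n.
apply: has_gauss_moments_add IH (increment_gauss_moments _ _ j dt0 W).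
apply: indep_rv_increment => //; exact: measurable_euler_increment.
Qed.

(** The covariance of [Y i] and [Y (i + m)] is [r^m v_i], so this is the Gaussian pair formula. The
    induction on [m] expands the square of [r Y + D]; its cross term calls for integrability of
    [Y_i^2 Y_(i+m)], so that third-order moment is carried along. *)
Lemma euler_mixed_moment w dt r i m : 0 < dt -> wiener_process P w ->
  let Y := euler_rv r (increment w dt) in let v := euler_var r dt in
  has_mean P (fun t => Y i t ^+ 2 * Y (i + m)%N t ^+ 2)
    (v i * v (i + m)%N + 2 * r ^+ (2 * m) * v i ^+ 2).
Proof.
move=> dt0 W Y v.
have gY j : has_gauss_moments P (Y j) (v j) by exact: euler_gauss_moments.
suff [] : has_mean P (fun t => Y i t ^+ 2 * Y (i + m)%N t ^+ 2)
    (v i * v (i + m)%N + 2 * r ^+ (2 * m) * v i ^+ 2) /\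
    has_mean P (fun t => Y i t ^+ 2 * Y (i + m)%N t) 0 by [].
elim: m => [|m [IH2 IH1]].
  split.
    apply: has_mean_eq (gY i 4%N isT) => [t|]; rewrite addn0 /=; ring.
  by apply: has_mean_eq (gY i 3%N isT) => [t|]; rewrite ?addn0 /=; ring.
pose D := increment w dt (i + m).
have gD := increment_gauss_moments w dt (i + m) dt0 W.
have mYi : measurable_fun setT (Y i : g_sigma_algebraType (cylinders (increment w dt) (i + m)) -> R).
  by apply: measurable_euler_increment; rewrite leq_addr.
have mYm : measurable_fun setT (Y (i + m)%N : g_sigma_algebraType (cylinders (increment w dt) (i + m)) -> R).
  exact: measurable_euler_increment.
have iD : indep_rv P (fun t => Y i t ^+ 2) D.
  by apply: indep_rv_increment => //; exact: measurable_funX.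
have iYD : indep_rv P (fun t => Y i t ^+ 2 * Y (i + m)%N t) D.
  by apply: indep_rv_increment => //; apply: measurable_funM => //; exact: measurable_funX.
have iD2 : indep_rv P (fun t => Y i t ^+ 2) (fun t => D t ^+ 2).
  apply: (indep_rv_comp P _ D id (fun x => x ^+ 2)) => //; exact: measurable_funX.
have D1 : has_mean P D 0 by apply: has_mean_eq (gD 1%N isT) => // t; rewrite expr1.
have D2 : has_mean P (fun t => D t ^+ 2) dt.
  by apply: has_mean_eq (gD 2%N isT) => //=; ring.
have Y2 : has_mean P (fun t => Y i t ^+ 2) (v i).
  by apply: has_mean_eq (gY i 2%N isT) => //=; ring.
split.
  apply: has_mean_eq (has_meanD P _ _ _ _ (has_meanZ P _ _ (r ^+ 2) IH2)
     (has_meanD P _ _ _ _ (has_meanZ P _ _ (2 * r) (has_meanM P _ _ _ _ iYD IH1 D1))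
       (has_meanM P _ _ _ _ iD2 Y2 D2))) => [t|].
  - rewrite addnS /Y /euler_rv /= -/(D t); ring.
  - rewrite addnS /v /= -/v mulnS exprD; ring.
apply: has_mean_eq (has_meanD P _ _ _ _ (has_meanZ P _ _ r IH1)
  (has_meanM P _ _ _ _ iD Y2 D1)) => [t|].
- rewrite addnS /Y /euler_rv /= -/(D t); ring.
- ring.
Qed.

(** Constraining every other process by [setT] leaves two factors in the product rule. *)
Lemma cylinders_processes_indep (M : nat) (ws : 'I_M -> R -> T -> R) i i' dt n A B :
  independent_processes P ws -> i != i' ->
  cylinders (fun j => ws i (j%:R * dt)) n A ->
  cylinders (fun j => ws i' (j%:R * dt)) n B ->
  (P (A `&` B) = P A * P B)%E.
Proof.
move=> ind ii' [C mC ->] [C' mC' ->].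
pose E (k : 'I_M) (j : 'I_n) : set R := if k == i then C j else if k == i' then C' j else setT.
have mE k j : measurable (E k j) by rewrite /E; case: ifP => // _; case: ifP.
have := ind n (fun j => (j : nat)%:R * dt) E mE.
pose S (k : 'I_M) := \bigcap_(j in [set: 'I_n]) (ws k ((j : nat)%:R * dt) @^-1` E k j).
have Si : S i = \bigcap_(j < n) (ws i (j%:R * dt) @^-1` C j).
  rewrite /S /E eqxx; apply/seteqP; split=> t tC j jn; first exact: (tC (Ordinal jn)).
  exact: (tC j (ltn_ord j)).
have Si' : S i' = \bigcap_(j < n) (ws i' (j%:R * dt) @^-1` C' j).
  rewrite /S /E eq_sym (negbTE ii') eqxx; apply/seteqP; split=> t tC j jn; first exact: (tC (Ordinal jn)).
  exact: (tC j (ltn_ord j)).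
have SE k : k != i -> k != i' -> S k = setT.
  move=> ki ki'; rewrite /S /E (negbTE ki) (negbTE ki').
  by apply/seteqP; split.
rewrite -Si -Si' -/S.
have -> : \bigcap_(k in [set: 'I_M]) S k = S i `&` S i'.
  apply/seteqP; split=> [t tS|t [ti ti'] k _]; first by split; exact: tS.
  have [->//|ki] := eqVneq k i; have [->//|ki'] := eqVneq k i'.
  by rewrite SE.
move=> ->; rewrite (bigD1 i)//= (bigD1 i')/= 1?eq_sym// big1 ?mule1// => k /andP[ki ki'].
by rewrite -/(S k) SE// probability_setT.
Qed.

End wiener_increments.

(** * Moments of the Langevin process *)

Section gauss_limits.
Context {d : measure_display} {T : measurableType d} {R : realType}.
Variable P : probability T R.
Implicit Types (U V : nat -> T -> R) (X Y : T -> R) (u v c : nat -> R).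

Lemma cvg_gauss_moment u (u0 : R) p : u @ \oo --> u0 ->
  gauss_moment (u n) p @[n --> \oo] --> gauss_moment u0 p.
Proof.
move=> uu0; have [m] := ubnP p; elim: m p => // m IH [|[|p]] pm.
- exact: cvg_cst.
- exact: cvg_cst.
- apply: cvgM; last by apply: IH; exact: (ltnW (n := m)).
  by apply: cvgMr.
Qed.

Lemma cvg_has_ubound (b : nat -> R) (b0 : R) : b @ \oo --> b0 -> exists K, forall n, b n <= K.
Proof.
move=> bb0; have /cvg_seq_bounded : cvgn b by apply/cvg_ex; exists b0.
move=> [M [_ Mb]]; exists (M + 1) => n.
by apply: le_trans (ler_norm _) _; apply: (Mb (M + 1)) => //; rewrite ltrDl.
Qed.

Lemma has_gauss_moments_sqr X (v : R) : has_gauss_moments P X v ->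
  has_mean P (fun t => X t ^+ 2) v.
Proof. by move=> gX; apply: has_mean_eq (gX 2%N isT) => //=; ring. Qed.

Lemma gauss_limit_sqr U X u (u0 : R) :
  (forall n, has_gauss_moments P (U n) (u n)) -> u @ \oo --> u0 ->
  measurable_fun setT X -> {ae P, forall t, U ^~ t @ \oo --> X t} ->
  has_mean P (fun t => X t ^+ 2) u0.
Proof.
move=> gU uu0 mX UX.
have [K hK] := cvg_has_ubound _ _ (cvg_gauss_moment _ _ 4 uu0).
apply: (@ae_cvg_has_mean _ _ _ P (fun n t => U n t ^+ 2) _ u
  (fun n => gauss_moment (u n) 4) u0 K) => //.
- by move=> n; exact: has_gauss_moments_sqr.
- by move=> n t; exact: sqr_ge0.
- by move=> n; apply: has_mean_eq (gU n 4%N isT) => //= t; rewrite -exprM.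
- exact: measurable_funX.
- by move=> t; exact: sqr_ge0.
- by apply: filterS UX => t Ut; rewrite expr2; under eq_fun do rewrite expr2; exact: cvgM.
Qed.

Lemma gauss_limit_sqr2 U V X Y u v c (u0 v0 c0 : R) :
  (forall n, has_gauss_moments P (U n) (u n)) -> u @ \oo --> u0 ->
  (forall n, has_gauss_moments P (V n) (v n)) -> v @ \oo --> v0 ->
  measurable_fun setT X -> {ae P, forall t, U ^~ t @ \oo --> X t} ->
  measurable_fun setT Y -> {ae P, forall t, V ^~ t @ \oo --> Y t} ->
  (forall n, has_mean P (fun t => U n t ^+ 2 * V n t ^+ 2) (c n)) -> c @ \oo --> c0 ->
  has_mean P (fun t => X t ^+ 2 * Y t ^+ 2) c0.
Proof.
move=> gU uu0 gV vv0 mX UX mY VY Zc cc0.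
pose b n := gauss_moment (u n) 8 + gauss_moment (v n) 8.
have [K hK] : exists K, forall n, b n <= K.
  apply: (cvg_has_ubound _ (gauss_moment u0 8 + gauss_moment v0 8)).
  by apply: cvgD; exact: cvg_gauss_moment.
have bE n : has_mean P (fun t => U n t ^+ 8 + V n t ^+ 8) (b n).
  by apply: has_meanD; [exact: gU|exact: gV].
(* [x y <= x^2 + y^2] for the fourth powers; this second moment is only bounded, never computed. *)
have Zb n t : (U n t ^+ 2 * V n t ^+ 2) ^+ 2 <= U n t ^+ 8 + V n t ^+ 8.
  rewrite exprMn -!exprM !(exprM _ 4 2); set x := _ ^+ 4; set y := _ ^+ 4; nra.
have Zs n : exists s, has_mean P (fun t => (U n t ^+ 2 * V n t ^+ 2) ^+ 2) s.
  apply: (has_mean_dominated P _ _ _ _ (bE n)) => [|t].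
    by apply: measurable_funX; exact: has_mean_measurable (Zc n).
  by rewrite ger0_norm ?sqr_ge0.
pose s n := sval (cid (Zs n)).
have sE n : has_mean P (fun t => (U n t ^+ 2 * V n t ^+ 2) ^+ 2) (s n).
  by rewrite /s; case: cid.
apply: (@ae_cvg_has_mean _ _ _ P (fun n t => U n t ^+ 2 * V n t ^+ 2) _ c s c0 K) => //.
- by move=> n t; rewrite mulr_ge0 ?sqr_ge0.
- by move=> n; apply: le_trans (hK n); exact: has_mean_le (sE n) (bE n) (Zb n).
- by apply: measurable_funM; exact: measurable_funX.
- by move=> t; rewrite mulr_ge0 ?sqr_ge0.
- apply: filterS2 UX VY => t Ut Vt; rewrite !expr2; under eq_fun do rewrite !expr2.
  by apply: cvgM; exact: cvgM.
Qed.

End gauss_limits.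

Section langevin_moments.
Context {d : measure_display} {Omega : measurableType d} {R : realType}.
Variable P : probability Omega R.
Variables (a sigma : R).
Hypotheses (a0 : a < 0) (sigma0 : 0 < sigma).
Implicit Types (w x : R -> Omega -> R) (h : R).

Definition ou_var (t : R) : R := (expR (2 * a * t) - 1) / (2 * a).

(** A geometric sum, cleared of a denominator that may vanish. *)
Lemma euler_varE (r v : R) j : euler_var r v j * (r ^+ 2 - 1) = v * (r ^+ (2 * j) - 1).
Proof.
elim: j => [|j IH]; first by rewrite muln0 expr0 subrr mul0r mulr0.
by rewrite /= mulrDl -mulrA IH mulnS exprD; ring.
Qed.

Lemma cvg_euler_factor h k : 
  (1 + a * (h / n.+1%:R)) ^+ (2 * (k * n.+1)) @[n --> \oo] --> expR (2 * a * (k%:R * h)).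
Proof.
have -> : expR (2 * a * (k%:R * h)) = expR (a * h) ^+ (2 * k).
  by rewrite -expRM_natl natrM; congr expR; ring.
have -> : (fun n => (1 + a * (h / n.+1%:R)) ^+ (2 * (k * n.+1))) =
   (fun n => ((1 + (a * h) / n.+1%:R) ^+ n.+1) ^+ (2 * k)).
  by apply/funext => n; rewrite -exprM mulrA mulnA [(n.+1 * _)%N]mulnC.
have cX : {for expR (a * h), continuous (fun z : R => z ^+ (2 * k))}.
  exact: exprn_continuous.
exact: (cvg_comp _ _ (cvg_one_plus_div (a * h)) cX).
Qed.

Lemma cvg_euler_var h k : 0 < h ->
  euler_var (1 + a * (h / n.+1%:R)) (h / n.+1%:R) (k * n.+1) @[n --> \oo] -->
  ou_var (k%:R * h).
Proof.
move=> h0.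
have hc : h / n.+1%:R @[n --> \oo] --> 0.
  by rewrite -[X in _ --> X](mulr0 h); apply: cvgMr; exact: cvg_harmonic.
have dc : 2 * a + a ^+ 2 * (h / n.+1%:R) @[n --> \oo] --> 2 * a.
  rewrite -[X in _ --> X]addr0 -(mulr0 (a ^+ 2)); apply: cvgD; first exact: cvg_cst.
  exact: cvgMr.
have a20 : 2 * a != 0 by rewrite mulf_neq0// lt_eqF.
(* For [r = 1 + a dt], [r^2 - 1 = dt (2 a + a^2 dt)]; one [dt] cancels, and the remaining
   denominator tends to [2 a], hence is eventually nonzero. *)
have lim : ((1 + a * (h / n.+1%:R)) ^+ (2 * (k * n.+1)) - 1) / (2 * a + a ^+ 2 * (h / n.+1%:R))
    @[n --> \oo] --> ou_var (k%:R * h).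
  apply: cvgM; last exact: cvgV.
  by apply: cvgB; [exact: cvg_euler_factor|exact: cvg_cst].
apply: cvg_trans lim; apply: near_eq_cvg.
have nz : \forall n \near \oo, 2 * a + a ^+ 2 * (h / n.+1%:R) != 0.
  move/cvgrPdist_lt : dc => /(_ (- (2 * a))) [|N _ HN].
    by rewrite oppr_gt0 nmulr_llt0.
  exists N => // n /HN; apply: contraTN => /eqP ->.
  by rewrite subr0 ltr0_norm ?ltxx// nmulr_llt0.
apply: filterS nz => n nz /=; apply: (mulIf nz); rewrite divfK//.
have dn0 : h / n.+1%:R != 0 by rewrite gt_eqF// divr_gt0.
by apply: (mulfI dn0); rewrite -euler_varE; ring.
Qed.

Lemma langevin_ae_cvg w x h k : 0 < h -> wiener_process P w -> solves_langevin P a sigma w x ->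
  {ae P, forall om,
    euler_rv (1 + a * (h / n.+1%:R)) (increment w (h / n.+1%:R)) (k * n.+1) om
      @[n --> \oo] --> sigma^-1 * x (k%:R * h) om}.
Proof.
move=> h0 [_ w0 _ _ _] [_ sol]; apply: filterS2 w0 sol => om w0 [cx xE].
have unscale (u : nat -> R) l : sigma * u n @[n --> \oo] --> l -> u @ \oo --> sigma^-1 * l.
  move=> H; rewrite (_ : u = fun n => sigma^-1 * (sigma * u n)).
    by apply: cvgM H; exact: cvg_cst.
  by apply/funext => n; rewrite mulKf// gt_eqF.
apply: unscale.
exact: (euler_cvg (x ^~ om) (w ^~ om) a sigma h k a0 h0 cx w0 xE).
Qed.

Lemma langevin_gauss w h k n : 0 < h -> wiener_process P w ->
  has_gauss_moments P
    (euler_rv (1 + a * (h / n.+1%:R)) (increment w (h / n.+1%:R)) (k * n.+1))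
    (euler_var (1 + a * (h / n.+1%:R)) (h / n.+1%:R) (k * n.+1)).
Proof. by move=> h0 W; apply: euler_gauss_moments => //; rewrite divr_gt0. Qed.

Lemma langevin_measurable w x t : solves_langevin P a sigma w x ->
  measurable_fun setT (fun om => sigma^-1 * x t om).
Proof. by move=> [mx _]; exact: measurable_funM. Qed.

Lemma langevin_second_moment w x h k : 0 < h -> wiener_process P w ->
  solves_langevin P a sigma w x ->
  has_mean P (fun om => x (k%:R * h) om ^+ 2) (sigma ^+ 2 * ou_var (k%:R * h)).
Proof.
move=> h0 W sol.
have H := gauss_limit_sqr P _ _ _ _ (fun n => langevin_gauss w h k n h0 W)
  (cvg_euler_var h k h0) (langevin_measurable w x (k%:R * h) sol)
  (langevin_ae_cvg w x h k h0 W sol).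
apply: has_mean_eq (has_meanZ P _ _ (sigma ^+ 2) H) => // om.
by rewrite exprMn mulrA -exprMn divff ?gt_eqF// expr1n mul1r.
Qed.

Lemma langevin_fourth_moment w x h k m : 0 < h -> wiener_process P w ->
  solves_langevin P a sigma w x ->
  has_mean P (fun om => x (k%:R * h) om ^+ 2 * x ((k + m)%:R * h) om ^+ 2)
   (sigma ^+ 4 * (ou_var (k%:R * h) * ou_var ((k + m)%:R * h) +
      2 * expR (2 * a * (m%:R * h)) * ou_var (k%:R * h) ^+ 2)).
Proof.
move=> h0 W sol.
pose v n := euler_var (1 + a * (h / n.+1%:R)) (h / n.+1%:R).
pose c n := v n (k * n.+1)%N * v n ((k + m) * n.+1)%N +
  2 * (1 + a * (h / n.+1%:R)) ^+ (2 * (m * n.+1)) * v n (k * n.+1)%N ^+ 2.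
have H := gauss_limit_sqr2 P _ _ _ _ _ _ c _ _ (ou_var (k%:R * h) * ou_var ((k + m)%:R * h) +
      2 * expR (2 * a * (m%:R * h)) * ou_var (k%:R * h) ^+ 2)
  (fun n => langevin_gauss w h k n h0 W) (cvg_euler_var h k h0)
  (fun n => langevin_gauss w h (k + m) n h0 W) (cvg_euler_var h (k + m) h0)
  (langevin_measurable w x (k%:R * h) sol) (langevin_ae_cvg w x h k h0 W sol)
  (langevin_measurable w x ((k + m)%:R * h) sol) (langevin_ae_cvg w x h (k + m) h0 W sol).
apply: has_mean_eq (has_meanZ P _ _ (sigma ^+ 4) (H _ _)) => [om|//|n|].
- by rewrite !exprMn !exprVn; field; rewrite gt_eqF.
- have hn : 0 < h / n.+1%:R by rewrite divr_gt0.
  rewrite /c /v mulnDl; exact: euler_mixed_moment.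
- apply: cvgD; first by apply: cvgM; exact: cvg_euler_var.
  apply: cvgM; last by rewrite expr2; under eq_fun do rewrite expr2; apply: cvgM; exact: cvg_euler_var.
  by apply: cvgM; [exact: cvg_cst|exact: cvg_euler_factor].
Qed.

(** Independence is assumed of the noises [ws]. It passes to the schemes, which are functions of
    grid values of the noise, and the factored moments then converge. *)
Lemma langevin_indep_moment (M : nat) (ws xs : 'I_M -> R -> Omega -> R) i i' h k m :
  0 < h -> i != i' -> independent_processes P ws ->
  (forall i, wiener_process P (ws i)) ->
  (forall i, solves_langevin P a sigma (ws i) (xs i)) ->
  has_mean P (fun om => xs i (k%:R * h) om ^+ 2 * xs i' (m%:R * h) om ^+ 2)
   (sigma ^+ 4 * (ou_var (k%:R * h) * ou_var (m%:R * h))).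
Proof.
move=> h0 ii' ind W sol.
pose v n := euler_var (1 + a * (h / n.+1%:R)) (h / n.+1%:R).
have H := gauss_limit_sqr2 P _ _ _ _ _ _ (fun n => v n (k * n.+1)%N * v n (m * n.+1)%N) _ _
  (ou_var (k%:R * h) * ou_var (m%:R * h))
  (fun n => langevin_gauss (ws i) h k n h0 (W i)) (cvg_euler_var h k h0)
  (fun n => langevin_gauss (ws i') h m n h0 (W i')) (cvg_euler_var h m h0)
  (langevin_measurable _ _ (k%:R * h) (sol i)) (langevin_ae_cvg _ _ h k h0 (W i) (sol i))
  (langevin_measurable _ _ (m%:R * h) (sol i')) (langevin_ae_cvg _ _ h m h0 (W i') (sol i')).
apply: has_mean_eq (has_meanZ P _ _ (sigma ^+ 4) (H _ _)) => [om|//|n|].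
- by rewrite !exprMn !exprVn; field; rewrite gt_eqF.
- set dt := h / n.+1%:R.
  have square_mean l o : has_mean P (fun om => euler_rv (1 + a * dt) (increment (ws l) dt) (o * n.+1) om ^+ 2)
      (v n (o * n.+1)%N).
    by apply: has_gauss_moments_sqr; exact: langevin_gauss.
  apply: has_meanM => //.
  pose Y l o := euler_rv (1 + a * dt) (increment (ws l) dt) (o * n.+1).
  apply: (indep_rv_comp P (Y i k) (Y i' m) (fun x : R => x ^+ 2) (fun x : R => x ^+ 2));
    try exact: measurable_funX.
  (* One length for both schemes; the extra unit counts the final grid time, which the last
     increment uses. *)
  pose G l := cylinders (fun j => ws l (j%:R * dt)) ((k + m) * n.+1).+1.
  have mG l o : (o <= k + m)%N -> measurable_fun setT
      (Y l o : g_sigma_algebraType (G l) -> R).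
    move=> okm; apply: measurable_euler_rv => j jo.
    have jkm : (j < (k + m) * n.+1)%N by rewrite (leq_trans jo)// leq_mul2r okm orbT.
    apply: measurable_funB.
      exact: (cylinders_measurable_fun (fun j => ws l (j%:R * dt)) _ j.+1).
    exact: (cylinders_measurable_fun (fun j => ws l (j%:R * dt)) _ j (leqW jkm)).
  have GM l : G l `<=` measurable.
    by apply: cylinders_measurable => j; case: (W l).
  apply: (indep_rv_sigma_algebra P (G i) (G i')) => //.
  + exact: cylinders_setI.
  + exact: cylinders_setI.
  + exact: cylinders_setT.
  + exact: cylinders_setT.
  + by move=> A B; exact: cylinders_processes_indep.
  + by apply: mG; rewrite leq_addr.
  + by apply: mG; rewrite leq_addl.
- by apply: cvgM; exact: cvg_euler_var.
Qed.

End langevin_moments.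

(** * Closed forms and the mean square error *)

Section closed_forms.
Context {R : realType}.
Implicit Types (q : R) (N : nat).

Lemma sum_geometric_sub1 q N : q != 1 ->
  \sum_(k < N) (q ^+ k - 1) = (q ^+ N - 1) / (q - 1) - N%:R.
Proof.
move=> q1; have q1' : q - 1 != 0 by rewrite subr_eq0.
elim: N => [|N IH]; first by rewrite big_ord0 expr0 subrr mul0r subr0.
by rewrite big_ord_recr/= IH [q ^+ N.+1]exprS -natr1; field.
Qed.

(** The row, and by symmetry the column, gained by the double covariance sum when [N] grows by
    one. *)
Lemma sum_geometric_row q N : q != 1 ->
  \sum_(k < N) q ^+ (N - k) * (q ^+ k - 1) ^+ 2 =
  (q ^+ N - 1) * (q ^+ N + q) / (q - 1) - 2 * N%:R * q ^+ N.
Proof.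
move=> q1; have q1' : q - 1 != 0 by rewrite subr_eq0.
elim: N => [|N IH]; first by rewrite big_ord0 expr0; field.
rewrite big_ord_recr/= subSnn.
rewrite (eq_bigr (fun k : 'I_N => q * (q ^+ (N - k) * (q ^+ k - 1) ^+ 2))); last first.
  by move=> k _; rewrite subSn ?exprS ?mulrA// ltnW.
by rewrite -big_distrr/= IH [q ^+ N.+1]exprS -natr1; field.
Qed.

(** With truncated subtraction, the exponent is the distance between [k] and [l]. For
    [q = exp (2 a h)] the summand is, up to a constant, the squared covariance of [x(kh)] and
    [x(lh)]; the closed form is the bracket of [E2] with [T = N h]. *)
Lemma sum_geometric_covariance q N : q != 1 ->
  \sum_(k < N) \sum_(l < N) q ^+ ((l - k) + (k - l)) * (q ^+ minn k l - 1) ^+ 2 =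
  ((q ^+ N - 1) * (4 * q + q ^+ N + 1) - (q - 1) * (q + 4 * q ^+ N + 1) * N%:R)
    / (q - 1) ^+ 2.
Proof.
move=> q1; have q1' : q - 1 != 0 by rewrite subr_eq0.
elim: N => [|N IH]; first by rewrite big_ord0 expr0; field.
under eq_bigr do rewrite big_ord_recr/=.
rewrite big_ord_recr/= big_split/= IH.
have row1 : \sum_(k < N) q ^+ ((N - k) + (k - N)) * (q ^+ minn k N - 1) ^+ 2 =
    \sum_(k < N) q ^+ (N - k) * (q ^+ k - 1) ^+ 2.
  apply: eq_bigr => k _; have kN := ltnW (ltn_ord k).
  by move: (kN); rewrite -subn_eq0 => /eqP ->; rewrite addn0 (minn_idPl kN).
have row2 : \sum_(k < N) q ^+ ((k - N) + (N - k)) * (q ^+ minn N k - 1) ^+ 2 =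
    \sum_(k < N) q ^+ (N - k) * (q ^+ k - 1) ^+ 2.
  by rewrite -row1; apply: eq_bigr => k _; rewrite addnC minnC.
rewrite row1 row2 sum_geometric_row// subnn addn0 minnn expr0 mul1r [q ^+ N.+1]exprS -natr1.
by field.
Qed.

End closed_forms.

(** * The exact cost [V_T] *)

Section mean_cost.
Context {d : measure_display} {Omega : measurableType d} {R : realType}.
Variable P : probability Omega R.

Lemma is_derive_expR_scale (b t : R) :
  is_derive t 1 (fun t : R => expR (b * t)) (b * expR (b * t)).
Proof.
rewrite (_ : (fun t => _) = expR \o (fun t => b * t))//.
by apply: is_derive_eq; rewrite /GRing.scale/=; ring.
Qed.

Lemma continuous_ou_var (a : R) : continuous (ou_var a).
Proof.
move=> t; apply: cvgM; last exact: cvg_cst.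
apply: cvgB; last exact: cvg_cst.
by case: (is_derive_expR_scale (2 * a) t) => /derivable1_diffP/differentiable_continuous.
Qed.

Lemma integral_ou_var (a T : R) : a < 0 -> 0 < T ->
  (\int[lebesgue_measure]_(t in `[0%R, T]%classic) (ou_var a t)%:E =
   (((expR (2 * a * T) - 1) / (2 * a) - T) / (2 * a))%:E)%E.
Proof.
move=> a0 T0; have a20 : a != 0 by rewrite lt_eqF.
pose F (t : R) : R := (2 * a)^-1 * ((2 * a)^-1 * expR (2 * a * t) - t).
have dF (t : R) : is_derive t 1 F (ou_var a t).
  have dE := is_derive_expR_scale (2 * a) t.
  by rewrite /F; apply: is_derive_eq; rewrite /ou_var /GRing.scale/=; field.
have cF : continuous F.
  by move=> t; apply/differentiable_continuous/derivable1_diffP; case: (dF t).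
rewrite (@continuous_FTC2 R (ou_var a) F 0 T)//.
- by rewrite -EFinB; congr EFin; rewrite /F mulr0 expR0; field.
- by apply: continuous_subspaceT => t; exact: continuous_ou_var.
- split.
  + by move=> t _; case: (dF t).
  + by apply: cvg_at_right_filter; exact: cF.
  + by apply: cvg_at_left_filter; exact: cF.
- by move=> t _; rewrite derive1E; case: (dF t).
Qed.

Lemma langevin_cost (a sigma T : R) (w x : R -> Omega -> R) :
  a < 0 -> 0 < sigma -> 0 < T -> wiener_process P w -> solves_langevin P a sigma w x ->
  (\int[lebesgue_measure]_(t in `[0%R, T]%classic) 'E_P[fun om => (x t om ^+ 2)%R] =
  (sigma ^+ 2 * (((expR (2 * a * T) - 1) / (2 * a) - T) / (2 * a)))%:E)%E.
Proof.
move=> a0 s0 T0 W sol.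
have mom t : 0 <= t -> ('E_P[fun om => (x t om ^+ 2)%R] = (sigma ^+ 2)%:E * (ou_var a t)%:E)%E.
  (* The moments are known at times [k h] for any [h > 0]: time 0 is [k = 0] with [h = 1], and time
     [t > 0] is [k = 1] with [h = t]. *)
  rewrite le_eqVlt => /predU1P[<-|t0].
    have := langevin_second_moment P a sigma a0 s0 w x 1 0 ltr01 W sol.
    by rewrite mul0r => /has_mean_expectation ->.
  have := langevin_second_moment P a sigma a0 s0 w x t 1 t0 W sol.
  by rewrite mul1r => /has_mean_expectation ->.
transitivity (\int[lebesgue_measure]_(t in `[0%R, T]%classic)
    ((sigma ^+ 2)%:E * (ou_var a t)%:E))%E.
  by apply: eq_integral => t; rewrite inE/= in_itv/= => /andP[t0 _]; exact: mom.
rewrite integralZl//; last first.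
  apply: continuous_compact_integrable; first exact: segment_compact.
  by apply: continuous_subspaceT => t; exact: continuous_ou_var.
by rewrite integral_ou_var.
Qed.

End mean_cost.

Theorem theorem3p1 (d : measure_display) (Omega : measurableType d) (R : realType)
  (P : probability Omega R) (a sigma T h : R) (N M : nat)
  (w x : R -> Omega -> R) (ws xs : 'I_M -> R -> Omega -> R) :
  a < 0 -> 0 < sigma -> 0 < T -> 0 < h -> (0 < N)%N -> N%:R * h = T -> (0 < M)%N ->
  wiener_process P w -> solves_langevin P a sigma w x ->
  (forall i, wiener_process P (ws i)) -> independent_processes P ws ->
  (forall i, solves_langevin P a sigma (ws i) (xs i)) ->
  let VT : R := fine (\int[lebesgue_measure]_(t in `[0%R, T]%classic) 'E_P[fun om => (x t om ^+ 2)%R])%E in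
  let Vhat : Omega -> R := fun om =>
    M%:R^-1 * \sum_(i < M) \sum_(k < N) h * xs i (k%:R * h) om ^+ 2 in
  let B : R := (M * N)%:R in
  'E_P[fun om => ((Vhat om - VT) ^+ 2)%R]%E = (E1 sigma h T a + E2 sigma h T a / B)%:E.
Proof.
move=> a0 s0 T0 h0 N0 NhT M0 W sol Ws ind sols VT Vhat B.
have VTE : VT = sigma ^+ 2 * (((expR (2 * a * T) - 1) / (2 * a) - T) / (2 * a)).
  by rewrite /VT (langevin_cost P a sigma T w x).
pose q := expR (2 * a * h).
have qE k : expR (2 * a * (k%:R * h)) = q ^+ k.
  by rewrite /q -expRM_natl; congr expR; ring.
have q1 : q != 1.
  rewrite -[1]expR0 (inj_eq (@expR_inj R)) mulf_eq0 (gt_eqF h0) orbF.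
  by rewrite mulf_neq0// lt_eqF.
have VqE k : ou_var a (k%:R * h) = (q ^+ k - 1) / (2 * a) by rewrite /ou_var qE.
pose v k := sigma ^+ 2 * ((q ^+ k - 1) / (2 * a)).
(* The covariance of the squares [x^2(kh)] and [x^2(lh)], twice the squared covariance of [x(kh)]
   and [x(lh)]. *)
pose cov k l := sigma ^+ 4 * (2 * q ^+ ((l - k) + (k - l)) * ((q ^+ minn k l - 1) / (2 * a)) ^+ 2).
have mean1 i k : has_mean P (fun om => xs i (k%:R * h) om ^+ 2) (v k).
  by rewrite /v -VqE; exact: langevin_second_moment (Ws i) (sols i).
have mean2_le i k l : (k <= l)%N ->
    has_mean P (fun om => xs i (k%:R * h) om ^+ 2 * xs i (l%:R * h) om ^+ 2) (v k * v l + cov k l).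
  move=> kl; have := langevin_fourth_moment P a sigma a0 s0 (ws i) (xs i) h k (l - k) h0 (Ws i) (sols i).
  rewrite (subnKC kl); apply: has_mean_eq => //.
  rewrite !VqE qE /cov (minn_idPl kl) (eqP (_ : k - l == 0)%N) ?subn_eq0// addn0 /v; ring.
have mean2 i k l :
    has_mean P (fun om => xs i (k%:R * h) om ^+ 2 * xs i (l%:R * h) om ^+ 2) (v k * v l + cov k l).
  have [kl|/ltnW lk] := leqP k l; first exact: mean2_le.
  apply: has_mean_eq (mean2_le i l k lk) => [om|]; first exact: mulrC.
  by rewrite /cov addnC minnC mulrC.
have mean2' i i' k l : i != i' ->
    has_mean P (fun om => xs i (k%:R * h) om ^+ 2 * xs i' (l%:R * h) om ^+ 2) (v k * v l).
  move=> ii'; have := langevin_indep_moment P a sigma a0 s0 M ws xs i i' h k l h0 ii' ind Ws sols.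
  by apply: has_mean_eq => //; rewrite !VqE /v; ring.
pose S i om := \sum_(k < N) h * xs i (k%:R * h) om ^+ 2.
pose m := \sum_(k < N) h * v k.
pose s := \sum_(k < N) \sum_(l < N) h ^+ 2 * cov k l.
have mS i : has_mean P (S i) m.
  by apply: has_mean_sum => k; apply: has_meanZ; exact: mean1.
have SS i i' om : S i om * S i' om = \sum_(k < N) \sum_(l < N)
    h ^+ 2 * (xs i (k%:R * h) om ^+ 2 * xs i' (l%:R * h) om ^+ 2).
  by rewrite /S big_distrlr /=; apply: eq_bigr => k _; apply: eq_bigr => l _; ring.
have mm : m * m = \sum_(k < N) \sum_(l < N) h ^+ 2 * (v k * v l).
  by rewrite /m big_distrlr /=; apply: eq_bigr => k _; apply: eq_bigr => l _; ring.
(* Distinct episodes are uncorrelated, so the variance [s] enters only on the diagonal: [M] times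
   among the [M^2] pairs. *)
have mSS i i' : has_mean P (fun om => S i om * S i' om) (m * m + (i == i')%:R * s).
  have [<-|ii'] := eqVneq i i'.
    apply: (has_mean_eq P _ _ _ _ (fun om => esym (SS i i om)) _ (has_mean_sum P _ _ _ (fun k =>
      has_mean_sum P _ _ _ (fun l => has_meanZ P _ _ (h ^+ 2) (mean2 i k l))))).
    rewrite mul1r mm /s -big_split/=; apply: eq_bigr => k _.
    by rewrite -big_split/=; apply: eq_bigr => l _; rewrite mulrDr.
  apply: (has_mean_eq P _ _ _ _ (fun om => esym (SS i i' om)) _ (has_mean_sum P _ _ _ (fun k =>
    has_mean_sum P _ _ _ (fun l => has_meanZ P _ _ (h ^+ 2) (mean2' i i' k l ii'))))).
  by rewrite mul0r addr0 mm.
have Mn0 : M%:R != 0 :> R by rewrite pnatr_eq0 -lt0n.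
have Nn0 : N%:R != 0 :> R by rewrite pnatr_eq0 -lt0n.
have mean_sum : has_mean P (fun om => \sum_(i < M) S i om) (M%:R * m).
  apply: has_mean_eq (has_mean_sum P _ _ _ mS) => //.
  by rewrite sumr_const card_ord mulr_natl.
have mean_sum2 : has_mean P (fun om => (\sum_(i < M) S i om) ^+ 2) (M%:R ^+ 2 * m ^+ 2 + M%:R * s).
  apply: (has_mean_eq P _ _ _ _ _ _ (has_mean_sum P _ _ _ (fun i => has_mean_sum P _ _ _ (mSS i)))) => [om|].
    by rewrite expr2 big_distrlr.
  rewrite (eq_bigr (fun=> M%:R * (m * m) + s)) => [|i _].
    by rewrite sumr_const card_ord -mulr_natl; ring.
  rewrite big_split/= sumr_const card_ord; congr (_ + _); first by rewrite mulr_natl.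
  rewrite (bigD1 i)//= eqxx mul1r big1 ?addr0// => j.
  by rewrite eq_sym => /negbTE ->; rewrite mul0r.
have mse : has_mean P (fun om => (Vhat om - VT) ^+ 2) ((m - VT) ^+ 2 + s / M%:R).
  apply: has_mean_eq (has_meanD P _ _ _ _ (has_meanZ P _ _ (M%:R ^- 2) mean_sum2)
    (has_meanD P _ _ _ _ (has_meanZ P _ _ (- (2 * VT / M%:R)) mean_sum)
      (has_mean_cst P (VT ^+ 2)))) => [om|].
    by rewrite /Vhat -/(S _ om); field.
  by field.
rewrite (has_mean_expectation _ _ _ mse); congr EFin.
have an0 : a != 0 by rewrite lt_eqF.
have TE : expR (2 * a * T) = q ^+ N by rewrite -NhT qE.
have mE : m = sigma ^+ 2 * h / (2 * a) * ((q ^+ N - 1) / (q - 1) - N%:R).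
  rewrite -sum_geometric_sub1// /m big_distrr/=; apply: eq_bigr => k _; rewrite /v; ring.
have sE : s = sigma ^+ 4 * h ^+ 2 / (2 * a ^+ 2) *
   (((q ^+ N - 1) * (4 * q + q ^+ N + 1) - (q - 1) * (q + 4 * q ^+ N + 1) * N%:R)
    / (q - 1) ^+ 2).
  rewrite -sum_geometric_covariance// /s big_distrr/=; apply: eq_bigr => k _.
  rewrite big_distrr/=; apply: eq_bigr => l _; rewrite /cov.
  by field.
have q1' : q - 1 != 0 by rewrite subr_eq0.
(* Substituting [T = N h], the squared bias is [E1], and the factor [T] of [E2] over [B = M N]
   leaves [h / M], which matches [s / M]. *)
rewrite mE sE VTE /E1 /E2 TE -/q -NhT /B natrM.
by field; rewrite an0 q1' Mn0 Nn0.
Qed.
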